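(* Let $K$ be a number field of degree $d\geq 2$ with ring of integers $\mathcal{O}_K$, and let $n$ be a positive integer. For integers $L>\max(n+d,2n+2)$ and $M\geq 1$, let $S=S_{L,M}=\{\xi_1,\ldots,\xi_{n+d}\}$ be the random subset of $\mathcal{O}_K$ constructed in the context, and let $P_{L,M}$ be the probability that $S_{L,M}$ is not $n$-universal. Then $$\lim_{L\to\infty}\lim_{M\to\infty}P_{L,M}=0.$$
   Context: A finite subset $S\subset\mathcal{O}_K$ is $n$-universal if for every polynomial $P\in K[X]$ of degree at most $n$ one has $P(\mathcal{O}_K)\subset\mathcal{O}_K$ if and only if $P(S)\subset\mathcal{O}_K$. A finite subset $T\subset\mathcal{O}_K$ is almost uniformly distributed modulo an ideal $I$ if for all $a,b\in\mathcal{O}_K$ one has $|\{s\in T: s\equiv a \pmod I\}|-|\{s\in T: s\equiv b\pmod I\}|\in\{-1,0,1\}$. $N(I)=|\mathcal{O}_K/I|$. Construction of $S_{L,M}$. Fix a $\mathbf{Z}$-basis $\omega_1,\ldots,\omega_d$ of $\mathcal{O}_K$. Let $\nu_i=\frac12(\delta_{\omega_i}+\delta_{-\omega_i})$ (Dirac measures), let $\nu=\nu_1*\cdots*\nu_d$ (convolution), and let $\mu=\mu_M=\nu^{*M}$ be the $M$-fold convolution power, i.e. the law after $M$ steps of the random walk on $\mathcal{O}_K$ started at $0$ with step distribution $\nu$. For each integer $L>\max(n+d,2n+2)$ fix elements $a_1,\ldots,a_{n+d}\in\mathcal{O}_K$ (depending on $L$ but not on $M$) such that at least $n+1$ of them are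 distinct modulo $L!$, $a_1,\ldots,a_{n+1}$ are pairwise distinct, and $\{a_1,\ldots,a_{n+1}\}$ is almost uniformly distributed modulo every positive power of every nonzero prime ideal $\mathfrak{p}$ of $\mathcal{O}_K$ with $N(\mathfrak{p})\leq L$. Let $\psi_1,\ldots,\psi_{n+d}$ be independent $\mathcal{O}_K$-valued random variables with distribution $\mu_M$, and put $\xi_i=a_i+L!\,\psi_i$.
   Formalization: The choice of a_1,…,a_{n+d} is also required to have at least n+1 elements distinct modulo each prime ideal 𝔭 dividing L! with N(𝔭)>L; without this the claim fails, e.g. d=2, n=1, (a_1,a_2,a_3)=(0,q,0) with q inert and q≤L<q². *)

(* Defs.v *)
From HB Require Import structures.
From mathcomp Require Import all_boot all_order all_algebra all_field finmap.
From mathcomp Require Import all_classical all_reals all_analysis.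

Set Implicit Arguments.
Unset Strict Implicit.
Unset Printing Implicit Defensive.

Import Order.TTheory GRing.Theory Num.Theory.
Import numFieldNormedType.Exports.

Local Open Scope classical_set_scope.
Local Open Scope ring_scope.

Section RingOfIntegers.
Variable K : fieldExtType rat.

Definition algInt : {pred K} :=
  fun x => `[< integralOver (intr : int -> K) x >].

Fact algInt_subring : subring_closed algInt.
Proof.
split; first by apply/asboolP; exact: (integral1 (intr : {rmorphism int -> K})).
- move=> x y /asboolP Ix /asboolP Iy; apply/asboolP.
  exact: (@integral_sub _ _ (intr : {rmorphism int -> K})).
- move=> x y /asboolP Ix /asboolP Iy; apply/asboolP.
  exact: (@integral_mul _ _ (intr : {rmorphism int -> K})).
Qed.

HB.instance Definition _ := GRing.isSubringClosed.Build K algInt algInt_subring.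

Record ringOfIntegers := RingOfIntegers {
  OKval : K;
  OKvalP : OKval \in algInt }.

HB.instance Definition _ := [isSub for OKval].
HB.instance Definition _ := [Choice of ringOfIntegers by <:].
HB.instance Definition _ := [SubChoice_isSubComNzRing of ringOfIntegers by <:].

HB.instance Definition _ := isPointed.Build ringOfIntegers 0.
HB.instance Definition _ := @isMeasurable.Build default_measure_display
  ringOfIntegers discrete_measurable discrete_measurable0
  discrete_measurableC discrete_measurableU.

End RingOfIntegers.

Arguments algInt : clear implicits.

Section Ideals.
Variable A : comNzRingType.
Implicit Types I J : set A.

Definition ideal_mul I J : set A :=
  [set x | exists m (u v : 'I_m -> A),
    (forall i, I (u i) /\ J (v i)) /\ x = \sum_(i < m) u i * v i].

(* The zeroth power is the unit ideal. *)
Definition ideal_exp I (k : nat) : set A := iter k (ideal_mul I) setT.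

Definition principal (c : A) : set A := [set x | exists y, x = c * y].

Definition nonzero_ideal I := exists2 x, I x & x != 0.

(* N(p) <= L, where N(p) is the number of elements of A / p *)
Definition ideal_norm_le (p : prime_idealr A) (L : nat) : Prop :=
  ([set: {ideal_quot p}] #<= `I_L)%card.

Definition residue_count I (T : {fset A}) (a : A) : nat :=
  #|` [fset s in T | `[< I (s - a) >]]%fset|.

Definition almost_uniform (T : {fset A}) I :=
  forall a b : A,
    (residue_count I T a)%:Z - (residue_count I T b)%:Z \in [:: -1; 0; 1 : int].

(* At least k of the a_i are pairwise incongruent modulo I. *)
Definition distinct_mod (k m : nat) (a : 'I_m -> A) I :=
  exists2 B : {set 'I_m}, (k <= #|B|)%N &
    forall i j, i \in B -> j \in B -> I (a i - a j) -> i = j.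

End Ideals.

Section Universal.
Variable K : fieldExtType rat.

Definition universal (n : nat) (S : {fset ringOfIntegers K}) :=
  forall P : {poly K}, (size P <= n.+1)%N ->
    (forall x : ringOfIntegers K, P.[val x] \in algInt K) <->
    (forall x : ringOfIntegers K, x \in S -> P.[val x] \in algInt K).

Definition integral_basis (d : nat) (omega : 'I_d -> ringOfIntegers K) :=
  forall x : ringOfIntegers K,
    exists! c : {ffun 'I_d -> int}, x = \sum_(i < d) omega i *~ c i.

(* "At least n+1 of the a_i are distinct modulo L!": distinctness of residue
   classes modulo the ideal (L!) is supplemented by distinctness modulo each
   prime divisor p of L! with N(p) > L. The latter does not follow from the
   former, nor from almost uniform distribution modulo powers of the primes of
   norm <= L. It cannot be dropped: if q is a rational prime which is inert in
   a quadratic field, q <= L < q^2 and n = 1, then (a_1, a_2, a_3) = (0, q, 0)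
   has all the other properties, but a_i + L! x_i always lies in q O_K, and
   then X / q shows that no set of such elements is universal. *)
Definition distinct_mod_factorial (n d L : nat)
    (a : 'I_(n + d) -> ringOfIntegers K) :=
  distinct_mod n.+1 a (principal L`!%:R) /\
  forall p : prime_idealr (ringOfIntegers K),
    nonzero_ideal [set` p] -> L`!%:R \in p -> ~ ideal_norm_le p L ->
    distinct_mod n.+1 a [set` p].

(* The indices of a_1, ..., a_(n+1) are the i : 'I_(n + d) with i < n.+1. *)
Definition admissible (n d L : nat) (a : 'I_(n + d) -> ringOfIntegers K) :=
  [/\ distinct_mod_factorial L a,
      forall i j : 'I_(n + d), (i < n.+1)%N -> (j < n.+1)%N ->
        a i = a j -> i = j
    & forall (p : prime_idealr (ringOfIntegers K)) (k : nat),
        nonzero_ideal [set` p] -> ideal_norm_le p L -> (0 < k)%N ->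
        almost_uniform [fset a i | i : 'I_(n + d) & (i < n.+1)%N]%fset
          (ideal_exp [set` p] k)].

Definition random_set (n d L : nat) (a : 'I_(n + d) -> ringOfIntegers K)
    (x : 'I_(n + d) -> ringOfIntegers K) : {fset ringOfIntegers K} :=
  [fset (a i + L`!%:R * x i)%R | i : 'I_(n + d)]%fset.

End Universal.

Section RandomWalk.
Variables (R : realType) (K : fieldExtType rat).
Local Notation measureOK := {measure set (ringOfIntegers K) -> \bar R}.

Section Convolution.
Local Open Scope ereal_scope.
Variables m1 m2 : measureOK.

(* The image of the product measure of m1 and m2 under addition, written as an
   iterated integral; every subset of the ring of integers is measurable. *)
Definition convolution (A : set (ringOfIntegers K)) : \bar R :=
  \int[m1]_x m2 [set y | A (x + y)%R].

Let convolution0 : convolution set0 = 0.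
Proof. by rewrite /convolution; apply: integral0_eq => x _; rewrite measure0. Qed.

Let convolution_ge0 A : 0 <= convolution A.
Proof. exact: integral_ge0. Qed.

Let convolution_sigma_additive : semi_sigma_additive convolution.
Proof.
move=> F _ tF _; rewrite /convolution.
have -> : \int[m1]_x m2 [set y | (\bigcup_n F n) (x + y)%R] =
    \int[m1]_x \sum_(0 <= n <oo) m2 [set y | F n (x + y)%R].
  apply: eq_integral => x _.
  rewrite (_ : [set y | _] = \bigcup_n [set y | F n (x + y)%R])//.
  by rewrite measure_bigcup//; [apply: eq_eseriesl => i; rewrite in_setT
    | move=> i j _ _ [y [/= Fi Fj]]; apply: (tF i j) => //; exists (x + y)%R].
rewrite integral_nneseries//.
by apply: is_cvg_nneseries => n _ _; exact: integral_ge0.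
Qed.

HB.instance Definition _ := isMeasure.Build _ _ _ convolution
  convolution0 convolution_ge0 convolution_sigma_additive.

End Convolution.

Definition convolve (m1 m2 : measureOK) : measureOK := convolution m1 m2.

Definition unit_mass : measureOK := \d_(0 : ringOfIntegers K).

Definition sign_step (w : ringOfIntegers K) : measureOK :=
  mscale (2^-1)%:nng (measure_add \d_w \d_(- w)).

Definition step_law (d : nat) (omega : 'I_d -> ringOfIntegers K) : measureOK :=
  \big[convolve/unit_mass]_(i < d) sign_step (omega i).

Definition walk_law (d : nat) (omega : 'I_d -> ringOfIntegers K) (M : nat) :
    measureOK :=
  iter M (convolve (step_law omega)) unit_mass.

End RandomWalk.

(* The product rule for subfamilies is the case A i = setT off the subfamily. *)
Definition mutually_independent {d d' : measure_display} {T : measurableType d}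
    {T' : measurableType d'} {R : realType} (P : probability T R) (m : nat)
    (X : 'I_m -> {RV P >-> T'}) :=
  forall A : 'I_m -> set T', (forall i, measurable (A i)) ->
    P (\bigcap_(i in [set: 'I_m]) X i @^-1` A i) =
      (\prod_(i < m) P (X i @^-1` A i))%E.

(* Main.v *)
From HB Require Import structures.
Require Import Defs.
From mathcomp Require Import all_boot all_order all_algebra all_field finmap.
From mathcomp Require Import all_classical all_reals all_analysis.
From mathcomp Require Import perm.
From mathcomp Require Import zify ring lra.

Set Implicit Arguments.
Unset Strict Implicit.
Unset Printing Implicit Defensive.

Import Order.TTheory GRing.Theory Num.Theory.
Import numFieldNormedType.Exports.

Local Open Scope classical_set_scope.
Local Open Scope ring_scope.

(** The proof reduces universality to conditions at the prime ideals and then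
    estimates how often these fail.

    A set of points is universal exactly when, at every nonzero prime [p], each
    polynomial of degree at most [n] that is integral at the points is
    [p]-integral at all integers: the multipliers that make a value integral form
    an ideal ([integral_of_local]).  Lagrange interpolation gives this as soon as
    [n + 1] of the points are distinct modulo [p], or are almost uniformly
    distributed modulo all powers of [p] ([count_prod_dvd]).  At the primes that
    contain [L`!], the random points have the classes of the chosen [a i] and
    this always holds.  At any other prime, universality fails when the points
    are crowded, that is, when they meet at most [n] classes
    ([crowded_not_universal]).  So the random set fails to be universal exactly
    when it is crowded modulo some prime that does not contain [L`!]
    ([universal_random_setP]).  The arithmetic used here is elementary: the ring
    of integers is a lattice, its residue rings modulo integers are finite, and
    its localisations at primes are discrete valuation rings
    ([uniformizer_exists]).

    The coordinates of the walk are independent simple random walks on the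
    integers ([has_law_walk]), and the monotonicity of the binomial coefficients
    shows that after [M] steps a coordinate falls in a class modulo an odd [q] with
    probability [1 / q + O(M ^ (-1/2))], uniformly in [q] ([class_frequency]).
    Being crowded means at least [d >= 2] coincidences among the [n + d] points
    ([crowded_two_repeats]).  Up to [r], the integer part of the square root of
    [M], crowding above a rational prime [q] therefore has probability
    [O(q ^ (-2))], and these bounds have a convergent sum.  For primes above [r]
    the first coincidence forces the prime to divide a nonzero difference of
    points; that leaves boundedly many primes, and the second coincidence costs a
    factor [O(1 / r)].  Hence crowding at the primes above [Y] has probability
    [O(1 / Y) + O(1 / r)] ([freq_crowded_beyond_le]).

    Crowding at the primes between [L] and [Y] depends on the walks modulo a fixed
    odd integer, and its probability converges by equidistribution
    ([residue_event_cvg]).  Letting [Y] grow, the failure probability converges for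
    fixed [L]; taking [Y = L] bounds its limit by [O(1 / L)]
    ([limit_probability]). *)

(** * Prime ideals of commutative rings *)

Section PrimeIdeals.
Variable A : comNzRingType.
Implicit Types (I J p : set A).

Definition is_ideal I :=
  [/\ I 0, forall x y, I x -> I y -> I (x + y) & forall a x, I x -> I (a * x)].

Definition is_prime p :=
  [/\ is_ideal p, ~ p 1 & forall x y, p (x * y) -> p x \/ p y].

Section IdealClosure.
Variables (I : set A) (idI : is_ideal I).

Lemma ideal0 : I 0. Proof. by case: idI. Qed.
Lemma idealD x y : I x -> I y -> I (x + y). Proof. by case: idI => _ + _; apply. Qed.
Lemma ideal_mull a x : I x -> I (a * x). Proof. by case: idI => _ _; apply. Qed.
Lemma ideal_mulr a x : I x -> I (x * a). Proof. by rewrite mulrC; apply: ideal_mull. Qed.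
Lemma idealN x : I x -> I (- x). Proof. by rewrite -mulN1r; apply: ideal_mull. Qed.
Lemma idealB x y : I x -> I y -> I (x - y).
Proof. by move=> Ix Iy; apply: idealD => //; apply: idealN. Qed.
Lemma ideal_sum (T : Type) (r : seq T) (P : pred T) (F : T -> A) :
  (forall i, P i -> I (F i)) -> I (\sum_(i <- r | P i) F i).
Proof. by move=> IF; apply: big_ind => //; [exact: ideal0|exact: idealD]. Qed.
Lemma idealBC x y : I (x - y) -> I (y - x).
Proof. by move=> Ixy; rewrite -opprB; exact: idealN. Qed.
Lemma idealB_trans x y z : I (x - y) -> I (y - z) -> I (x - z).
Proof. by move=> xy yz; rewrite -(subrK y x) -addrA; apply: idealD. Qed.
End IdealClosure.

Lemma prime_idealrP p : is_prime p -> exists P : prime_idealr A, [set` P] = p.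
Proof.
move=> [idp p1 pM].
pose S : {pred A} := fun x => `[< p x >].
have zS : zmod_closed S.
  split; first by apply/asboolP; exact: ideal0.
  by move=> x y /asboolP px /asboolP py; apply/asboolP; exact: idealB.
have iS : 1 \notin S /\ forall a, {in S, forall u, a * u \in S}.
  split; first by apply/asboolP.
  by move=> a x /asboolP px; apply/asboolP; exact: ideal_mull.
have pS : prime_idealr_closed S.
  by move=> x y /asboolP/pM[px|py]; apply/orP; [left|right]; apply/asboolP.
pose P : prime_idealr A := HB.pack S (GRing.isZmodClosed.Build A S zS)
  (isProperIdeal.Build A S iS) (isPrimeIdealrClosed.Build A S pS).
exists P; apply/seteqP; split => x /=.
  by move=> /asboolP.
by move=> px; apply/asboolP.
Qed.

(** A proper ideal that is maximal among proper ideals is prime, and Zorn's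
    lemma provides one above any given proper ideal. *)
Lemma proper_ideal_sub_prime I :
  is_ideal I -> ~ I 1 -> exists2 p, is_prime p & I `<=` p.
Proof.
move=> idI I1.
pose good (J : set A) := J = set0 \/ [/\ is_ideal J, ~ J 1 & I `<=` J].
have [F goodF totF|p [gp maxp]] := @Zorn_bigcup A good.
  have [[J0 [FJ0 [x0 J0x0]]]|noJ] := pselect (exists J, F J /\ J !=set0); last first.
    left; apply/seteqP; split => x //= [J FJ Jx]; apply: noJ.
    by exists J; split => //; exists x.
  have {}goodF J x : F J -> J x -> [/\ is_ideal J, ~ J 1 & I `<=` J].
    by move=> FJ Jx; have [E|//] := goodF _ FJ; rewrite E in Jx.
  right; split.
  - split.
    + by exists J0 => //; have [idJ _ _] := goodF _ _ FJ0 J0x0; exact: (ideal0 idJ).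
    + move=> x y [J FJ Jx] [J' FJ' J'y].
      have [JJ'|J'J] := totF _ _ FJ FJ'.
        exists J' => //; have [idJ _ _] := goodF _ _ FJ' J'y.
        by apply: idealD => //; exact: JJ'.
      exists J => //; have [idJ _ _] := goodF _ _ FJ Jx.
      by apply: idealD => //; exact: J'J.
    + move=> a x [J FJ Jx]; exists J => //.
      by have [idJ _ _] := goodF _ _ FJ Jx; exact: ideal_mull.
  - by move=> [J FJ J1]; have [] := goodF _ _ FJ J1.
  - by move=> x Ix; exists J0 => //; have [_ _] := goodF _ _ FJ0 J0x0; apply.
have goodI : good I by right; split.
have [idp p1 Ip] : [/\ is_ideal p, ~ p 1 & I `<=` p].
  case: gp => // p0; exfalso; apply: (maxp I) => //; rewrite p0.
  by split => // /(_ 0 (ideal0 idI)).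
exists p => //; split => // x y pxy.
have [px|npx] := pselect (p x); first by left.
right.
pose J : set A := [set z | exists a, p (z - a * x)].
have idJ : is_ideal J.
  split.
  - by exists 0; rewrite mul0r subr0; exact: ideal0.
  - move=> z z' [a pa] [a' pa']; exists (a + a').
    by rewrite mulrDl opprD addrACA; exact: idealD.
  - by move=> b z [a pa]; exists (b * a); rewrite -mulrA -mulrBr; exact: ideal_mull.
have pJ : p `<=` J by move=> z pz; exists 0; rewrite mul0r subr0.
have [[a pa]|J1] := pselect (J 1).
  rewrite -(mul1r y) -(subrK (a * x) 1) mulrDl.
  by apply: idealD => //; [exact: ideal_mulr|rewrite -mulrA; exact: ideal_mull].
exfalso; apply: (maxp J).
  split => // Jp; apply: npx; apply: Jp; exists 1.
  by rewrite mul1r subrr; exact: ideal0.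
by right; split => //; exact: subset_trans pJ.
Qed.

Lemma primeX p x k : is_prime p -> p (x ^+ k) -> p x.
Proof.
move=> [idp p1 pM]; elim: k => [|k IH]; first by rewrite expr0.
by rewrite exprS => /pM[//|].
Qed.

Lemma prime_prod p (T : eqType) (r : seq T) (P : pred T) (F : T -> A) :
  is_prime p -> p (\prod_(i <- r | P i) F i) ->
  exists2 i, (i \in r) && P i & p (F i).
Proof.
move=> [idp p1 pM]; elim: r => [|i r IH]; first by rewrite big_nil.
rewrite big_cons; case: ifP => Pi.
  move=> /pM[pFi|/IH[j /andP[jr Pj] pFj]].
    by exists i => //; rewrite mem_head.
  by exists j => //; rewrite in_cons jr orbT.
by move=> /IH[j /andP[jr Pj] pFj]; exists j => //; rewrite in_cons jr orbT.
Qed.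

Lemma principal_ideal c : is_ideal (principal c).
Proof.
split; first by exists 0; rewrite mulr0.
- by move=> x y [u ->] [v ->]; exists (u + v); rewrite mulrDr.
- by move=> a x [u ->]; exists (a * u); rewrite mulrCA.
Qed.

Lemma ideal_mul_ideal I J : is_ideal I -> is_ideal (ideal_mul I J).
Proof.
move=> idI; split.
- by exists 0%N, (fun _ => 0), (fun _ => 0); split; [case|rewrite big_ord0].
- move=> x y [m [u [v [uv ->]]]] [m' [u' [v' [uv' ->]]]].
  pose w (f : 'I_m -> A) (f' : 'I_m' -> A) (i : 'I_(m + m')) :=
    match fintype.split i with inl j => f j | inr j => f' j end.
  exists (m + m')%N, (w u u'), (w v v'); split.
    by move=> i; rewrite /w; case: (fintype.split i).
  rewrite big_split_ord; congr (_ + _); apply: eq_bigr => i _; rewrite /w.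
    by rewrite -[lshift _ i]/(unsplit (inl i)) unsplitK.
  by rewrite -[rshift _ i]/(unsplit (inr i)) unsplitK.
- move=> a x [m [u [v [uv ->]]]]; exists m, (fun i => a * u i), v; split.
    by move=> i; have [? ?] := uv i; split => //; exact: ideal_mull.
  by rewrite mulr_sumr; apply: eq_bigr => i _; rewrite mulrA.
Qed.

Lemma ideal_exp_ideal I k : is_ideal I -> is_ideal (ideal_exp I k).
Proof. by move=> idI; case: k => [|k]; [split|exact: ideal_mul_ideal]. Qed.

Lemma ideal_exp_X I x k : I x -> ideal_exp I k (x ^+ k).
Proof.
move=> Ix; elim: k => [//|k IH]; rewrite exprS.
exists 1%N, (fun _ => x), (fun _ => x ^+ k); split => //.
by rewrite big_ord_recl big_ord0 addr0.
Qed.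

Lemma ideal_exp_le I j k : is_ideal I -> (j <= k)%N ->
  ideal_exp I k `<=` ideal_exp I j.
Proof.
move=> idI; elim: k => [|k IH]; first by rewrite leqn0 => /eqP->.
rewrite leq_eqVlt => /predU1P[-> //|/IH{}IH].
apply: subset_trans IH => x [m [u [v [uv ->]]]].
apply: ideal_sum; first exact: ideal_exp_ideal.
by move=> i _; apply: ideal_mull; [exact: ideal_exp_ideal|case: (uv i)].
Qed.

End PrimeIdeals.

(** * Coordinates in the ring of integers *)

Section Lattice.
Variables (K : fieldExtType rat) (d : nat).
Hypothesis dimK : \dim {:K} = d.
Variable omega : 'I_d -> ringOfIntegers K.
Hypothesis basis_omega : integral_basis omega.
Local Notation O := (ringOfIntegers K).

Lemma OvalD (x y : O) : val (x + y) = val x + val y. Proof. exact: raddfD. Qed.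
Lemma OvalB (x y : O) : val (x - y) = val x - val y. Proof. exact: raddfB. Qed.
Lemma OvalM (x y : O) : val (x * y) = val x * val y. Proof. exact: rmorphM. Qed.
Lemma Oval_nat n : val (n%:R : O) = n%:R. Proof. exact: rmorph_nat. Qed.
Lemma OvalX (x : O) k : val (x ^+ k) = val x ^+ k. Proof. exact: rmorphXn. Qed.
Lemma Oval_sum (T : Type) (r : seq T) (P : pred T) (F : T -> O) :
  val (\sum_(i <- r | P i) F i) = \sum_(i <- r | P i) val (F i).
Proof. exact: raddf_sum. Qed.
Lemma Oval_prod (T : Type) (r : seq T) (P : pred T) (F : T -> O) :
  val (\prod_(i <- r | P i) F i) = \prod_(i <- r | P i) val (F i).
Proof. exact: rmorph_prod. Qed.
Lemma Oval_mulz (x : O) k : val (x *~ k) = val x *~ k.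
Proof. exact: raddfMz. Qed.

Lemma charK0 n : (n%:R == 0 :> K) = (n == 0)%N.
Proof. by rewrite -(rmorph_nat (in_alg K)) fmorph_eq0 pnatr_eq0. Qed.

Lemma Oval_eq0 (x : O) : (val x == 0) = (x == 0).
Proof. by rewrite -(inj_eq val_inj) rmorph0. Qed.

Lemma O_natr_eq0 n : (n%:R == 0 :> O) = (n == 0)%N.
Proof. by rewrite -Oval_eq0 Oval_nat charK0. Qed.

Lemma O_mulfI (c x y : O) : c != 0 -> c * x = c * y -> x = y.
Proof.
rewrite -Oval_eq0 => c0 /(congr1 val); rewrite !OvalM => /(mulfI c0).
exact: val_inj.
Qed.

Lemma O_mulf_neq0 (x y : O) : x != 0 -> y != 0 -> x * y != 0.
Proof. by rewrite -!Oval_eq0 OvalM; exact: mulf_neq0. Qed.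

Lemma O_expf_neq0 (x : O) k : x != 0 -> x ^+ k != 0.
Proof. by rewrite -!Oval_eq0 OvalX; exact: expf_neq0. Qed.

(** ** Coordinates *)

Definition comb (c : 'I_d -> int) : O := \sum_(i < d) omega i *~ c i.

Lemma combP (x : O) : exists c : {ffun 'I_d -> int}, x = comb c.
Proof. by have [c [-> _]] := basis_omega x; exists c. Qed.

Definition coo (x : O) : {ffun 'I_d -> int} := projT1 (cid (combP x)).

Lemma cooK x : comb (coo x) = x.
Proof. by rewrite /coo; case: cid. Qed.

Lemma combK (c : 'I_d -> int) i : coo (comb c) i = c i.
Proof.
have [c0 [_ uc]] := basis_omega (comb c).
have <- : c0 = coo (comb c) by apply: uc; rewrite -/(comb _) cooK.
have -> : c0 = [ffun i => c i].
  by apply: uc; apply: eq_bigr => j _; rewrite ffunE.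
by rewrite ffunE.
Qed.

Lemma combD (b c : 'I_d -> int) : comb b + comb c = comb (fun i => b i + c i).
Proof. by rewrite -big_split; apply: eq_bigr => i _; rewrite mulrzDr. Qed.

Lemma combN (c : 'I_d -> int) : - comb c = comb (fun i => - c i).
Proof. by rewrite -sumrN; apply: eq_bigr => i _; rewrite mulrNz. Qed.

Lemma combM (c : 'I_d -> int) m : m%:R * comb c = comb (fun i => c i * m%:Z).
Proof.
rewrite mulr_sumr; apply: eq_bigr => i _.
by rewrite mulrzA mulr_natl.
Qed.

Lemma cooD x y i : coo (x + y) i = coo x i + coo y i.
Proof. by rewrite -{1}(cooK x) -{1}(cooK y) combD combK. Qed.

Lemma cooN x i : coo (- x) i = - coo x i.
Proof. by rewrite -{1}(cooK x) combN combK. Qed.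

Lemma cooM m x i : coo (m%:R * x) i = coo x i * m%:Z.
Proof. by rewrite -{1}(cooK x) combM combK. Qed.

Lemma coo_inj : injective (fun x i => coo x i).
Proof.
move=> x y xy; rewrite -(cooK x) -(cooK y); apply: eq_bigr => i _.
by rewrite (congr1 (fun f => f i) xy).
Qed.

(** ** Residues modulo an integer *)

Section Residues.
Variable m : nat.
Hypothesis m_gt0 : (0 < m)%N.

Lemma residue_subproof (x : O) i : (`|(coo x i %% m%:Z)%Z|%N < m)%N.
Proof.
rewrite -ltz_nat gez0_abs ?modz_ge0 //; last by rewrite -lt0n.
by apply: ltz_pmod.
Qed.

Definition residue (x : O) : {ffun 'I_d -> 'I_m} :=
  [ffun i => Ordinal (residue_subproof x i)].

Lemma residueP x y : residue x = residue y <-> principal m%:R (x - y).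
Proof.
split=> [xy|[z xyz]].
  have m0 : m%:Z != 0 by rewrite eqz_nat -lt0n.
  exists (comb (fun i => (coo (x - y) i %/ m%:Z)%Z)); apply: coo_inj.
  apply/funext => i; rewrite cooM combK divzK //.
  rewrite cooD cooN -eqz_mod_dvd.
  have /ffunP/(_ i) := xy; rewrite !ffunE => /(congr1 val) /= /(congr1 Posz).
  by rewrite !gez0_abs ?modz_ge0 // => ->.
apply/ffunP => i; rewrite !ffunE; apply: val_inj => /=; congr absz.
apply/eqP; rewrite eqz_mod_dvd -cooN -cooD xyz cooM.
exact: dvdz_mull.
Qed.

Lemma card_residues : #|{ffun 'I_d -> 'I_m}| = (m ^ d)%N.
Proof. by rewrite card_ffun !card_ord. Qed.

Lemma pigeonhole_residue (T : finType) (f : T -> O) :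
  (m ^ d < #|T|)%N -> exists t1 t2, t1 != t2 /\ principal m%:R (f t1 - f t2).
Proof.
rewrite -card_residues => ltm.
have /injectivePn[t1 [t2 t12 ft]] : ~~ injectiveb (residue \o f).
  by apply/negP => /injectiveP/leq_card; rewrite leqNgt ltm.
by exists t1, t2; split => //; apply/residueP.
Qed.

(** Two powers of [x] agree in the finite ring of residues. *)
Lemma power_repeats (x : O) :
  exists i t, (0 < t)%N /\ principal m%:R (x ^+ i * (1 - x ^+ t)).
Proof.
have [|a [b [neq_ab ab]]] := @pigeonhole_residue 'I_(m ^ d).+1 (fun i => x ^+ i).
  by rewrite card_ord.
wlog lt_ab : a b neq_ab ab / (a < b)%N => [wl|].
  have [/wl|lt_ba|/val_inj/eqP] := ltngtP a b; first exact.
    apply: (wl b a) => //; first by rewrite eq_sym.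
    by apply: idealBC ab; exact: principal_ideal.
  by rewrite (negPf neq_ab).
exists a, (b - a)%N; rewrite subn_gt0; split => //.
by rewrite mulrBr mulr1 -exprD subnKC // ltnW.
Qed.

End Residues.

(** ** Denominators *)

Lemma common_denominator (r : 'I_d -> rat) :
  exists2 m, (0 < m)%N & exists c : 'I_d -> int, forall i, r i * m%:R = (c i)%:~R.
Proof.
have [m m0 Hm] : exists2 m, (0 < m)%N & forall i, (denq (r i) %| m%:Z)%Z.
  exists (\prod_(i < d) `|denq (r i)|)%N.
    by apply: prodn_gt0 => i; rewrite absz_gt0 denq_neq0.
  by move=> i; rewrite dvdzE /= (bigD1 i) //= dvdn_mulr.
exists m => //; exists (fun i => numq (r i) * (m%:Z %/ denq (r i))%Z) => i.
rewrite intrM; set a := (_ %/ _)%Z.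
have -> : m%:R = (denq (r i))%:~R * a%:~R :> rat.
  by rewrite -[LHS]/((m%:Z)%:~R) -(divzK (Hm i)) intrM mulrC.
rewrite -{1}(divq_num_den (r i)) mulrA divfK // intr_eq0; exact: denq_neq0.
Qed.

Lemma omega_free : free [seq val (omega i) | i <- enum 'I_d].
Proof.
pose X : d.-tuple K := [tuple val (omega i) | i < d].
rewrite -[[seq _ | _ <- _]]/(tval X); apply/freeP => r Hr.
have [m m0 [c Hc]] := common_denominator r.
have c0 : comb c = 0.
  apply: val_inj; rewrite rmorph0 Oval_sum.
  transitivity (m%:R *: \sum_(i < d) r i *: X`_i); last by rewrite Hr scaler0.
  rewrite scaler_sumr; apply: eq_bigr => i _.
  rewrite Oval_mulz scalerA mulrC Hc scaler_int; congr (_ *~ _).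
  by rewrite (nth_map i) ?size_enum_ord // nth_ord_enum.
move=> i; have := Hc i.
have -> : c i = 0.
  by rewrite -(combK c i) c0 -[0](mulr0 (0%:R)) cooM mulr0.
by move/eqP; rewrite mulf_eq0 pnatr_eq0 -[m == 0]negbK -lt0n m0 orbF => /eqP.
Qed.

Lemma denominator (z : K) : exists2 m, (0 < m)%N & exists y : O, z * m%:R = val y.
Proof.
pose X : d.-tuple K := [tuple val (omega i) | i < d].
have bX : basis_of fullv X.
  by rewrite basisEfree omega_free subvf dimK size_map size_enum_ord /=.
have [m m0 [c Hc]] := common_denominator (fun i => coord X i z).
exists m => //; exists (comb c).
rewrite {1}(coord_basis bX (memvf z)) mulr_suml Oval_sum; apply: eq_bigr => i _.
rewrite Oval_mulz -scaler_int -Hc !mulr_natr scalerMnl; congr (_ *: _).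
by rewrite (nth_map i) ?size_enum_ord // nth_ord_enum.
Qed.

Lemma integer_multiple (z : O) : z != 0 ->
  exists2 m, (0 < m)%N & exists y : O, z * y = m%:R.
Proof.
move=> z0; have [m m0 [y Hy]] := denominator (val z)^-1.
exists m => //; exists y; apply: val_inj.
by rewrite OvalM -Hy Oval_nat mulrA mulfV ?mul1r // Oval_eq0.
Qed.

End Lattice.

(** * Uniformizers at nonzero primes *)

Section PrimesOfO.
Variables (K : fieldExtType rat) (d : nat).
Hypothesis dimK : \dim {:K} = d.
Variable omega : 'I_d -> ringOfIntegers K.
Hypothesis basis_omega : integral_basis omega.
Local Notation O := (ringOfIntegers K).

Section NonzeroPrime.
Variable p : set O.
Hypotheses (prime_p : is_prime p) (p_neq0 : nonzero_ideal p).

Let idp : is_ideal p. Proof. by case: prime_p. Qed.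
Let p1 : ~ p 1. Proof. by case: prime_p. Qed.
Let pM x y : p (x * y) -> p x \/ p y. Proof. by case: prime_p => _ _; apply. Qed.

Lemma residue_char_exists : exists2 q, prime q & p q%:R.
Proof.
have [z pz z0] := p_neq0.
have [m m0 [y zy]] := integer_multiple dimK basis_omega z0.
have : p m%:R by rewrite -zy; exact: ideal_mulr.
rewrite (prod_prime_decomp m0) natr_prod prime_decompE big_map /=.
move=> /(prime_prod prime_p)[q /andP[q_m _]] pq; exists q.
  by move: q_m; rewrite mem_primes => /andP[].
by apply: (@primeX _ _ _ (logn q m)) => //; rewrite -natrX.
Qed.

(** Nonzero primes are maximal: some power of [D] is congruent to a higher
    power, and [D] can be cancelled modulo [p]. *)
Lemma inverse_mod_prime D : ~ p D -> exists E, p (1 - D * E).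
Proof.
move=> npD; have [q q_pr pq] := residue_char_exists.
have [i [t [t_gt0 [y]]]] := power_repeats basis_omega (prime_gt0 q_pr) D.
case: t t_gt0 => // t _ Hy.
exists (D ^+ t); rewrite -exprS.
have /pM[|//] : p (D ^+ i * (1 - D ^+ t.+1)) by rewrite Hy; exact: ideal_mulr.
by move=> /(primeX prime_p).
Qed.

(** With [t] the defect of an inverse modulo [p], the geometric series of [t]
    corrects it up to [t ^+ k]. *)
Lemma inverse_mod_prime_power D k : ~ p D ->
  exists E, ideal_exp p k (1 - D * E).
Proof.
move=> /inverse_mod_prime[E]; pose t := 1 - D * E; rewrite -/t => pt.
exists (E * \sum_(i < k) t ^+ i).
have <- : t ^+ k = 1 - D * (E * \sum_(i < k) t ^+ i).
  rewrite mulrA -[D * E](subKr 1) -/t -opprB mulNr -subrX1 opprB.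
  by rewrite subKr.
exact: ideal_exp_X.
Qed.

Section ResidueCharacteristic.
Variable q : nat.
Hypotheses (q_prime : prime q) (pq : p q%:R).

Lemma principal_sub : principal q%:R `<=` p.
Proof. by move=> _ [y ->]; exact: ideal_mulr. Qed.

Lemma natr_in_prime k : p k%:R <-> (q %| k)%N.
Proof.
split=> [pk|/dvdnP[m ->]]; last by rewrite natrM; exact: ideal_mull.
apply/negPn/negP => nqk; have := nqk; rewrite -prime_coprime // => cop.
case: (egcdnP k (prime_gt0 q_prime)) => u v Huv _.
apply: p1; have : p ((u * q)%:R - (v * k)%:R).
  by apply: idealB => //; rewrite natrM; exact: ideal_mull.
by rewrite Huv (eqP cop) natrD addrC addKr.
Qed.

(** Multiply [1] successively by the generators of [p]; powers of each of them
    eventually vanish modulo [q], locally at [p].  The last nonzero product is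
    annihilated by [p] modulo [q]. *)
Lemma annihilator_of_prime :
  exists b, (forall D, principal q%:R (D * b) -> p D) /\
            (forall z, p z -> principal q%:R (b * z)).
Proof.
have idq := principal_ideal (q%:R : O).
have q_gt0 := prime_gt0 q_prime.
suff step (s : seq O) : (forall z, z \in s -> p z) ->
    exists b, (forall D, principal q%:R (D * b) -> p D) /\
              (forall z, z \in s -> principal q%:R (b * z)).
  pose rep (c : {ffun 'I_d -> 'I_q}) := comb omega (fun i => (c i : nat)%:Z).
  pose s := [seq rep c | c <- enum {ffun 'I_d -> 'I_q} & `[< p (rep c) >]].
  have [|b [nb bs]] := step s.
    by move=> z /mapP[c]; rewrite mem_filter => /andP[/asboolP pc _] ->.
  exists b; split => // z pz; pose c := residue basis_omega q_gt0 z.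
  have zc : principal q%:R (z - rep c).
    apply/(residueP basis_omega q_gt0)/ffunP => i.
    rewrite !ffunE; apply: val_inj => /=; rewrite combK ffunE /= gez0_abs.
      by rewrite modz_mod.
    by rewrite modz_ge0 // eqz_nat -lt0n.
  have : principal q%:R (b * rep c).
    apply: bs; apply: map_f; rewrite mem_filter mem_enum andbT.
    apply/asboolP; rewrite -(subKr z (rep c)); apply: idealB => //.
    exact: principal_sub.
  rewrite -(subrK (rep c) z) mulrDr => bc.
  by apply: idealD => //; exact: ideal_mull.
elim: s => [|z s IH] ps.
  by exists 1; split => // D; rewrite mulr1 => /principal_sub.
have [|b [nb bs]] := IH; first by move=> y ys; apply: ps; rewrite in_cons ys orbT.
have pz : p z by apply: ps; rewrite mem_head.
pose P j := `[< exists2 D, ~ p D & principal q%:R (D * b * z ^+ j) >].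
have exP : exists j, P j.
  have [i [t [t0 Hi]]] := power_repeats basis_omega q_gt0 z.
  exists i; apply/asboolP; exists (1 - z ^+ t).
    case: t t0 Hi => // t _ _ pt; apply: p1; rewrite -(subrK (z ^+ t.+1) 1).
    by apply: idealD => //; rewrite exprS; exact: ideal_mulr.
  by rewrite mulrAC -mulrA mulrCA mulrA; exact: ideal_mulr.
case: (ex_minnP exP) => [[|j]] /asboolP[D npD HD] minj.
  by exfalso; apply: npD; apply: nb; rewrite -[D * b]mulr1.
exists (D * b * z ^+ j); split.
  move=> E; rewrite !mulrA => HE; have [//|pE] := pselect (p E).
  have : P j; last by move=> /minj; rewrite ltnn.
  by apply/asboolP; exists (E * D) => // /pM[].
move=> y; rewrite in_cons => /predU1P[->|ys].
  by have -> : D * b * z ^+ j * z = D * b * z ^+ j.+1 by rewrite exprSr !mulrA.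
have -> : D * b * z ^+ j * y = D * z ^+ j * (b * y).
  by ring.
by apply: ideal_mull => //; exact: bs.
Qed.

(** If every power of [t] has denominator [q], two distinct sums of powers
    agree up to an integer, and their difference is a polynomial relation whose
    leading coefficient is [1] or [-1]. *)
Lemma bounded_denominator_integral (t : K) :
  (forall k, exists y : O, val y = q%:R * t ^+ k) -> exists y : O, val y = t.
Proof.
move=> /choice[y Hy].
suff it : integralOver (intr : int -> K) t.
  have tO : t \in algInt K by apply/asboolP.
  by exists (RingOfIntegers tO).
pose N := (q ^ d)%N.
have [|A [B [nAB [w Hw]]]] := @pigeonhole_residue _ _ _ basis_omega _
    (prime_gt0 q_prime) {ffun 'I_N -> bool}
    (fun A => \sum_(i < N) if A i then y i.+1 else 0).
  by rewrite card_ffun card_bool card_ord -/N; apply: ltn_expl.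
pose e (i : 'I_N) : K := (A i)%:R - (B i)%:R.
have qK : q%:R != 0 :> K by rewrite charK0 -lt0n prime_gt0.
have rel : \sum_(i < N) e i * t ^+ i.+1 = val w.
  apply: (mulfI qK); rewrite -Oval_nat -OvalM -Hw OvalB !Oval_sum.
  rewrite -sumrB mulr_sumr; apply: eq_bigr => i _; rewrite /e Oval_nat mulrCA -Hy.
  by case: (A i); case: (B i); rewrite ?mulrBl ?mul1r ?mul0r ?rmorph0.
pose P : {poly K} := \sum_(i < N) e i *: 'X^(i.+1) - (val w)%:P.
have coefP (i : 'I_N) : P`_(i.+1) = e i.
  rewrite coefB coefC subr0 coef_sum (bigD1 i) //= coefZ coefXn eqxx mulr1.
  rewrite big1 ?addr0 // => j ji; rewrite coefZ coefXn eqSS.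
  by rewrite eq_sym (inj_eq val_inj) (negPf ji) mulr0.
have coefP0 : P`_0 = - val w.
  rewrite coefB coefC coef_sum big1 ?sub0r // => j _.
  by rewrite coefZ coefXn mulr0.
have coefPbig i : (N < i)%N -> P`_i = 0.
  move=> Ni; rewrite coefB coefC coef_sum big1 => [|j _].
    by case: i Ni => // i _; rewrite subr0.
  rewrite coefZ coefXn; case: eqP => [ij|_]; last by rewrite mulr0.
  by move: Ni; rewrite ij ltnS leqNgt ltn_ord.
have Pt : P.[t] = 0.
  rewrite hornerD hornerN hornerC horner_sum -rel; apply/eqP; rewrite subr_eq0.
  by apply/eqP/eq_bigr => i _; rewrite hornerZ hornerXn.
have [i0 ei0] : exists i, e i != 0.
  apply/existsP; rewrite -negb_forall; apply: contra nAB => /forallP e0.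
  apply/eqP/ffunP => i; move: (e0 i); rewrite /e subr_eq0.
  by case: (A i); case: (B i); rewrite ?oner_eq0 // eq_sym oner_eq0.
have szP : (1 < size P)%N.
  rewrite ltnNge; apply: contra ei0 => szP; rewrite -coefP nth_default //.
  exact: leq_trans szP _.
have lead1 : lead_coef P ^+ 2 = 1.
  have : lead_coef P != 0 by rewrite lead_coef_eq0 -size_poly_gt0 ltnW.
  rewrite lead_coefE; case: (size P) szP => [|[|k]] //= _.
  have [Nk|kN] := leqP N k; first by rewrite coefPbig ?eqxx.
  rewrite (coefP (Ordinal kN)) /e; case: (A _); case: (B _);
  by rewrite ?subrr ?eqxx // ?subr0 ?sub0r ?sqrrN expr1n.
apply: (@integral_root_monic _ _ _ t (lead_coef P *: P)).
- by rewrite monicE lead_coefZ -expr2 lead1.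
- by rewrite rootE hornerZ Pt mulr0.
have int_e i : integralOver (intr : int -> K) (e i).
  by rewrite /e; apply: integral_sub; apply: integral_nat.
have int_P i : integralOver (intr : int -> K) P`_i.
  case: i => [|i].
    by rewrite coefP0; apply: integral_opp; apply/asboolP; exact: OKvalP.
  have [Ni|iN] := leqP N i.
    rewrite (coefPbig i.+1 Ni).
    exact: (mxpoly.integral0 (intr : {rmorphism int -> K})).
  by rewrite (coefP (Ordinal iN)).
apply/integral_poly => i; rewrite coefZ lead_coefE.
exact: integral_mul.
Qed.

(** The localisation at [p] is a discrete valuation ring.  With [b] as in
    [annihilator_of_prime], multiplication by [b / q] maps [p] into the ring of
    integers.  If it mapped [p] into itself, all powers of [b / q] would have
    denominator [q], so that [b / q] would be integral; but [b] is not a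
    multiple of [q].  So [u = b * pi / q] is outside [p] for some [pi] in [p]. *)
Lemma uniformizer_exists :
  exists pi u, [/\ p pi, ~ p u & forall z, p z -> exists y, u * z = pi * y].
Proof.
have [b [nb bp]] := annihilator_of_prime.
have qK : q%:R != 0 :> K by rewrite charK0 -lt0n prime_gt0.
have qO : q%:R != 0 :> O by rewrite O_natr_eq0 -lt0n prime_gt0.
have [[pi [u [ppi pu Hpi]]]|stable] :=
    pselect (exists pi u, [/\ p pi, ~ p u & b * pi = q%:R * u]).
  exists pi, u; split => // z pz; have [y Hy] := bp _ pz.
  exists y; apply: (O_mulfI qO).
  transitivity (pi * (b * z)); last by rewrite Hy; ring.
  by rewrite mulrA -Hpi; ring.
exfalso; apply: p1.
have [y Hy] : exists y : O, val y = val b / q%:R.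
  apply: bounded_denominator_integral => k.
  suff [y _ Hy] : exists2 y : O, p y & val y = q%:R * (val b / q%:R) ^+ k.
    by exists y.
  elim: k => [|k [y py Hy]]; first by exists q%:R; rewrite ?mulr1 ?Oval_nat.
  have [z Hz] := bp _ py; exists z.
    by have [//|pz] := pselect (p z); exfalso; apply: stable; exists y, z.
  apply: (mulfI qK); rewrite -Oval_nat -OvalM -Hz OvalM Hy exprS Oval_nat.
  by rewrite mulrCA; congr (_ * _); rewrite mulrA mulrCA divff // mulr1.
apply: nb; exists y; apply: val_inj.
by rewrite mul1r OvalM Hy Oval_nat mulrCA divff // mulr1.
Qed.

End ResidueCharacteristic.
End NonzeroPrime.
End PrimesOfO.

(** * Valuations *)

Section Valuation.
Variables (K : fieldExtType rat) (d : nat).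
Hypothesis dimK : \dim {:K} = d.
Variable omega : 'I_d -> ringOfIntegers K.
Hypothesis basis_omega : integral_basis omega.
Local Notation O := (ringOfIntegers K).

Variable p : set O.
Hypotheses (prime_p : is_prime p) (p_neq0 : nonzero_ideal p).
Variables (pi u : O).
Hypotheses (p_pi : p pi) (np_u : ~ p u).
Hypothesis pi_gen : forall z, p z -> exists y, u * z = pi * y.

Let idp : is_ideal p. Proof. by case: prime_p. Qed.
Let p1 : ~ p 1. Proof. by case: prime_p. Qed.
Let pM x y : p (x * y) -> p x \/ p y. Proof. by case: prime_p => _ _; apply. Qed.
Let npM x y : ~ p x -> ~ p y -> ~ p (x * y). Proof. by move=> ? ? /pM[]. Qed.

Lemma notin_prime_neq0 x : ~ p x -> x != 0.
Proof. by move=> npx; apply/eqP => x0; apply: npx; rewrite x0; exact: ideal0. Qed.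

Lemma uniformizer_neq0 : pi != 0.
Proof.
apply/eqP => pi0; have [z pz z0] := p_neq0.
have [y] := pi_gen pz; rewrite pi0 mul0r => /eqP.
by rewrite (negPf (O_mulf_neq0 (notin_prime_neq0 np_u) z0)).
Qed.

Let piX_neq0 k : pi ^+ k != 0. Proof. exact: O_expf_neq0 uniformizer_neq0. Qed.

(** The exponent of [pi] in [z], up to factors outside [p]. *)
Definition has_val (z : O) k :=
  exists D y, [/\ ~ p D, ~ p y & D * z = pi ^+ k * y].

(** Dividing [u ^+ k * z] by [pi] as long as possible must stop: modulo a
    positive multiple of [z] the powers of [pi] repeat, so [z] divides a power
    of [pi] up to a factor outside [p], which bounds the number of divisions. *)
Lemma has_val_exists z : z != 0 -> exists k, has_val z k.
Proof.
move=> z0; have [m m0 [w zw]] := integer_multiple dimK basis_omega z0.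
have [i [t [t0 [y0 Hy0]]]] := power_repeats basis_omega m0 pi.
have npt : ~ p (1 - pi ^+ t).
  case: t t0 {Hy0} => // t _ pt; apply: p1; rewrite -(subrK (pi ^+ t.+1) 1).
  by apply: idealD => //; rewrite exprS; exact: ideal_mulr.
suff H k : (exists k, has_val z k) \/ exists y, u ^+ k * z = pi ^+ k * y.
  have [//|[y Hy]] := H i.+1; exfalso.
  have : u ^+ i.+1 * (1 - pi ^+ t) = pi * (y * (w * y0)).
    apply: (O_mulfI (piX_neq0 i)).
    transitivity (u ^+ i.+1 * (pi ^+ i * (1 - pi ^+ t))); first by ring.
    rewrite Hy0 -zw.
    transitivity (u ^+ i.+1 * z * (w * y0)); first by ring.
    by rewrite Hy exprSr; ring.
  move=> H'; have : p (u ^+ i.+1 * (1 - pi ^+ t)) by rewrite H'; exact: ideal_mulr.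
  by move=> /pM[/(primeX prime_p)|].
elim: k => [|k [|[y Hy]]]; [by right; exists z|by left|].
have [py|npy] := pselect (p y); last first.
  left; exists k, (u ^+ k), y; split => //.
  by move=> /(primeX prime_p).
right; have [y' Hy'] := pi_gen py; exists y'.
by rewrite exprS -mulrA Hy mulrCA Hy' exprSr mulrA.
Qed.

Lemma has_val_unique z j k : has_val z j -> has_val z k -> j = k.
Proof.
suff H i l : has_val z i -> has_val z l -> (i < l)%N -> False.
  move=> zj zk; have [jk|kj|//] := ltngtP j k; first by have := H _ _ zj zk jk.
  by have := H _ _ zk zj kj.
move=> [D [y [npD npy Dz]]] [D' [y' [npD' npy' Dz']]] il.
have : D' * y = pi * (pi ^+ (l - i.+1) * D * y').
  apply: (O_mulfI (piX_neq0 i)).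
  transitivity (D' * (pi ^+ i * y)); first by ring.
  rewrite -Dz.
  transitivity (D * (D' * z)); first by ring.
  rewrite Dz' -{1}(subnKC il) exprD exprSr; ring.
move=> E; have : p (D' * y) by rewrite E; exact: ideal_mulr.
exact: npM.
Qed.

Definition valuation (z : O) : nat := xget 0%N [set k | has_val z k].

Lemma valuationP z : z != 0 -> has_val z (valuation z).
Proof. by move=> /has_val_exists/(xgetPex 0%N). Qed.

Lemma valuation_eq z k : has_val z k -> valuation z = k.
Proof.
move=> zk; apply: (has_val_unique _ zk).
by apply: (xgetPex 0%N (P := [set k | has_val z k])); exists k.
Qed.

Lemma valuationM x y : x != 0 -> y != 0 ->
  valuation (x * y) = (valuation x + valuation y)%N.
Proof.
move=> /valuationP[D [a [npD npa Dx]]] /valuationP[D' [a' [npD' npa' Dy]]].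
apply: valuation_eq; exists (D * D'), (a * a'); split; [exact: npM|exact: npM|].
by rewrite mulrACA Dx Dy mulrACA exprD.
Qed.

Lemma valuation1 : valuation 1 = 0%N.
Proof. by apply: valuation_eq; exists 1, 1. Qed.

Lemma valuation_prod (T : finType) (P : pred T) (F : T -> O) :
  (forall i, P i -> F i != 0) ->
  \prod_(i | P i) F i != 0 /\
  valuation (\prod_(i | P i) F i) = (\sum_(i | P i) valuation (F i))%N.
Proof.
move=> F0; pose R (x : O) k := x != 0 /\ valuation x = k.
apply: (big_rec2 R); first by split; [exact: oner_neq0|exact: valuation1].
move=> i k x Pi [x0 <-]; split; first by apply: O_mulf_neq0 => //; exact: F0.
by rewrite valuationM //; exact: F0.
Qed.

Lemma ideal_exp_dvd k z : ideal_exp p k z -> exists y, u ^+ k * z = pi ^+ k * y.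
Proof.
elim: k z => [|k IH] z /=; first by exists z.
move=> [m [f [g [fg ->]]]].
have /choice[h Hh] : forall i : 'I_m, exists y,
    u ^+ k.+1 * (f i * g i) = pi ^+ k.+1 * y.
  move=> i; have [pf pg] := fg i.
  have [y Hy] := pi_gen pf; have [y' Hy'] := IH _ pg.
  exists (y * y').
  transitivity (u * f i * (u ^+ k * g i)); first by rewrite exprS; ring.
  by rewrite Hy Hy' exprS; ring.
exists (\sum_(i < m) h i); rewrite !mulr_sumr; apply: eq_bigr => i _.
exact: Hh.
Qed.

Lemma ideal_expE z k : z != 0 -> ideal_exp p k z <-> (k <= valuation z)%N.
Proof.
move=> z0; move: (valuation z) (valuationP z0) => v [D [y [npD npy Dz]]].
split=> [/ideal_exp_dvd[y' Hy']|kv].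
  rewrite leqNgt; apply/negP => vk.
  have : u ^+ k * y = pi * (pi ^+ (k - v.+1) * (D * y')).
    apply: (O_mulfI (piX_neq0 v)).
    transitivity (u ^+ k * (pi ^+ v * y)); first by ring.
    rewrite -Dz; transitivity (D * (u ^+ k * z)); first by ring.
    rewrite Hy' -{1}(subnKC vk) exprD exprSr; ring.
  move=> E; have : p (u ^+ k * y) by rewrite E; exact: ideal_mulr.
  by move=> /pM[/(primeX prime_p)|].
have idk := ideal_exp_ideal k idp.
have [E HE] := inverse_mod_prime_power dimK basis_omega prime_p p_neq0 k npD.
have -> : z = E * (D * z) + z * (1 - D * E) by ring.
apply: idealD => //; last exact: ideal_mull.
rewrite Dz; apply: ideal_mull => //; rewrite -(subnKC kv) exprD -mulrA.
by apply: ideal_mulr => //; exact: ideal_exp_X.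
Qed.

Lemma valuation_dvd x y : x != 0 -> y != 0 -> (valuation y <= valuation x)%N ->
  exists2 D, ~ p D & principal y (D * x).
Proof.
move=> /valuationP + /valuationP; move: (valuation x) (valuation y) => vx vy.
move=> [D [a [npD npa Dx]]] [D' [a' [npD' npa' Dy]]] vyx.
exists (D * a'); first exact: npM.
exists (D' * a * pi ^+ (vx - vy)).
rewrite mulrAC Dx -{1}(subnKC vyx) exprD.
transitivity ((pi ^+ vy * a') * (pi ^+ (vx - vy) * a)).
  by ring.
rewrite -Dy; ring.
Qed.

(** In this form sums of valuations can be compared one power of [p] at a
    time. *)
Lemma valuation_count z N : z != 0 -> (valuation z <= N)%N ->
  valuation z = (\sum_(k < N) `[< ideal_exp p k.+1 z >])%N.
Proof.
move=> z0 vN; rewrite -{1}(card_ord (valuation z)) -sum1_card.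
rewrite (big_ord_widen N (fun _ => 1%N) vN) big_mkcond; apply: eq_bigr => k _.
by rewrite (asbool_equiv_eq (ideal_expE k.+1 z0)) asboolb; case: ltnP.
Qed.

(** This makes the Lagrange interpolation polynomials at the points [s]
    [p]-integral.  Summed over all powers of [p], the hypothesis compares the
    valuations of numerator and denominator of the [i]-th one at [x]. *)
Lemma count_prod_dvd n (s : 'I_n.+1 -> O) i x :
    injective s -> (forall j, x != s j) ->
    (forall k, (0 < k)%N ->
       \sum_(j | j != i) `[< ideal_exp p k (s i - s j)%R >] <=
       \sum_(j | j != i) `[< ideal_exp p k (x - s j)%R >])%N ->
  exists2 D, ~ p D &
    principal (\prod_(j | j != i) (s i - s j)) (D * \prod_(j | j != i) (x - s j)).
Proof.
move=> s_inj xs cnt.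
have [x0 vx] := @valuation_prod _ (fun j => j != i) (fun j => x - s j)
  (fun j _ => etrans (congr1 negb (subr_eq0 x (s j))) (xs j)).
have [|y0 vy] := @valuation_prod _ (fun j => j != i) (fun j => s i - s j).
  by move=> j ji; rewrite subr_eq0 (inj_eq s_inj) eq_sym.
apply: valuation_dvd => //; rewrite vx vy.
pose N := (\sum_j valuation (s i - s j)%R + \sum_j valuation (x - s j)%R)%N.
have -> : (\sum_(j | j != i) valuation (s i - s j)%R =
    \sum_(j | j != i) \sum_(k < N) `[< ideal_exp p k.+1 (s i - s j)%R >])%N.
  apply: eq_bigr => j ji; apply: valuation_count.
    by rewrite subr_eq0 (inj_eq s_inj) eq_sym.
  by rewrite /N [X in (_ <= X + _)%N](bigD1 j) //= -addnA leq_addr.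
have -> : (\sum_(j | j != i) valuation (x - s j)%R =
    \sum_(j | j != i) \sum_(k < N) `[< ideal_exp p k.+1 (x - s j)%R >])%N.
  apply: eq_bigr => j ji; apply: valuation_count; first by rewrite subr_eq0.
  by rewrite /N [X in (_ <= _ + X)%N](bigD1 j) //= addnCA leq_addr.
rewrite exchange_big [X in (_ <= X)%N]exchange_big /=.
apply: leq_sum => k _. exact: (cnt k.+1 isT).
Qed.

End Valuation.

(** * Lagrange interpolation and universality *)

Section Lagrange.
Variables (F : fieldType) (n : nat) (s : 'I_n.+1 -> F).
Hypothesis s_inj : injective s.

Lemma lagrange_formula (P : {poly F}) (x : F) : (size P <= n.+1)%N ->
  P.[x] = \sum_i P.[s i] * (\prod_(j | j != i) (x - s j) /
                            \prod_(j | j != i) (s i - s j)).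
Proof.
move=> szP.
pose Q := \sum_i (P.[s i] / \prod_(j | j != i) (s i - s j)) *:
  \prod_(j | j != i) ('X - (s j)%:P).
have QE y : Q.[y] = \sum_i P.[s i] * (\prod_(j | j != i) (y - s j) /
    \prod_(j | j != i) (s i - s j)).
  rewrite horner_sum; apply: eq_bigr => i _; rewrite hornerZ horner_prod mulrAC.
  by rewrite mulrA; under eq_bigr do rewrite hornerXsubC.
rewrite -QE; suff -> : P = Q by [].
apply/eqP; rewrite -subr_eq0; apply/eqP.
apply: (@roots_geq_poly_eq0 _ _ [seq s i | i <- enum 'I_n.+1]).
- apply/allP => _ /mapP[i _ ->]; rewrite rootE hornerD hornerN QE subr_eq0.
  rewrite (bigD1 i) //= divff; last first.
    by apply/prodf_neq0 => j ji; rewrite subr_eq0 (inj_eq s_inj) eq_sym.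
  rewrite mulr1 big1 ?addr0 // => j ji; rewrite (bigD1 i) 1?eq_sym //=.
  by rewrite subrr !mul0r mulr0.
- by rewrite map_inj_uniq ?enum_uniq.
- rewrite size_map size_enum_ord; apply: leq_trans (size_polyD _ _) _.
  rewrite geq_max szP size_polyN; apply: leq_trans (size_sum _ _ _) _.
  apply/bigmax_leqP => i _.
  apply: leq_trans (size_scale_leq _ _) _.
  rewrite (eq_bigl (mem (predC1 i))) // -big_enum size_prod_XsubC.
  by rewrite -cardE cardC1 card_ord.
Qed.
End Lagrange.

Section Universality.
Variables (K : fieldExtType rat) (d : nat).
Hypothesis dimK : \dim {:K} = d.
Variable omega : 'I_d -> ringOfIntegers K.
Hypothesis basis_omega : integral_basis omega.
Local Notation O := (ringOfIntegers K).

Lemma algIntP (z : K) : z \in algInt K -> exists y : O, val y = z.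
Proof. by move=> zO; exists (RingOfIntegers zO). Qed.

Lemma OvalP (y : O) : val y \in algInt K. Proof. exact: OKvalP. Qed.

(** Integrality of a value can be tested at one prime after the other: the
    multipliers that make it integral form an ideal. *)
Lemma integral_of_local (z : K) :
  (forall p : set O, is_prime p -> nonzero_ideal p ->
     exists2 D, ~ p D & val D * z \in algInt K) -> z \in algInt K.
Proof.
move=> loc; pose I : set O := [set D | val D * z \in algInt K].
have IE D : I D = (val D * z \in algInt K) by [].
have [|nI1] := pselect (I 1); first by rewrite IE rmorph1 mul1r.
have idI : is_ideal I.
  split; first by rewrite IE rmorph0 mul0r rpred0.
    by move=> x y; rewrite !IE OvalD mulrDl; exact: rpredD.
  by move=> a x; rewrite !IE OvalM -mulrA; apply: rpredM; exact: OvalP.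
have [p prime_p Ip] := proper_ideal_sub_prime idI nI1.
have [m m0 [y Hy]] := denominator dimK basis_omega z.
have [|D npD DI] := loc _ prime_p; last by exfalso; apply: npD; exact: Ip.
exists (m%:R : O); last by rewrite O_natr_eq0 -lt0n.
by apply: Ip; rewrite IE Oval_nat mulrC Hy; exact: OvalP.
Qed.

(** The product of the multipliers [D] of the single Lagrange polynomials serves
    them all. *)
Lemma local_interpolation (p : set O) n (s : 'I_n.+1 -> O) (P : {poly K}) (x : O) :
  is_prime p -> injective s -> (size P <= n.+1)%N ->
  (forall i, P.[val (s i)] \in algInt K) ->
  (forall i, exists2 D, ~ p D & principal (\prod_(j | j != i) (s i - s j))
                                  (D * \prod_(j | j != i) (x - s j))) ->
  exists2 D, ~ p D & val D * P.[val x] \in algInt K.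
Proof.
move=> prime_p s_inj szP Ps /fin_all_exists2[D npD].
move=> /fin_all_exists[y Hy].
exists (\prod_i D i).
  by move=> /(prime_prod prime_p)[i _ pDi]; apply: npD pDi.
have sK_inj : injective (fun i => val (s i)).
  by move=> i j /val_inj/s_inj.
rewrite (lagrange_formula sK_inj _ szP) mulr_sumr rpred_sum // => i _.
have -> : val (\prod_i D i) * (P.[val (s i)] *
    (\prod_(j | j != i) (val x - val (s j)) /
     \prod_(j | j != i) (val (s i) - val (s j)))) =
   val (\prod_(j | j != i) D j) * (P.[val (s i)] * val (y i)).
  have dE : val (\prod_(j | j != i) (s i - s j)) =
      \prod_(j | j != i) (val (s i) - val (s j)).
    by rewrite Oval_prod; apply: eq_bigr => j _; rewrite OvalB.
  have xE : val (\prod_(j | j != i) (x - s j)) =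
      \prod_(j | j != i) (val x - val (s j)).
    by rewrite Oval_prod; apply: eq_bigr => j _; rewrite OvalB.
  have d0 : \prod_(j | j != i) (val (s i) - val (s j)) != 0.
    by apply/prodf_neq0 => j ji; rewrite subr_eq0 (inj_eq sK_inj) eq_sym.
  have -> : \prod_i D i = D i * \prod_(j | j != i) D j by rewrite (bigD1 i).
  rewrite OvalM [val (D i) * _]mulrC -mulrA; congr (_ * _).
  rewrite mulrCA; congr (_ * _); rewrite mulrA.
  apply: (mulIf d0); rewrite mulfVK // -xE -OvalM Hy OvalM dE mulrC.
  by [].
by apply: rpredM; [exact: OvalP|apply: rpredM; [exact: Ps|exact: OvalP]].
Qed.

(** The denominators in Lagrange interpolation are products of differences of
    points, which are outside [p]. *)
Lemma local_interpolation_distinct (p : set O) n (s : 'I_n.+1 -> O)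
    (P : {poly K}) (x : O) :
  is_prime p -> (forall i j, p (s i - s j) -> i = j) -> (size P <= n.+1)%N ->
  (forall i, P.[val (s i)] \in algInt K) ->
  exists2 D, ~ p D & val D * P.[val x] \in algInt K.
Proof.
move=> prime_p s_dist szP Ps.
have [idp _ _] := prime_p.
apply: local_interpolation (Ps) _ => //.
  by move=> i j sij; apply: s_dist; rewrite sij subrr; exact: ideal0.
move=> i; exists (\prod_(j | j != i) (s i - s j)); last first.
  by exists (\prod_(j | j != i) (x - s j)).
move=> /(prime_prod prime_p)[j /andP[_ ji] /s_dist ij].
by rewrite ij eqxx in ji.
Qed.

Lemma distinct_mod_seq (I : set O) n m (xi : 'I_m -> O) :
  distinct_mod n.+1 xi I ->
  exists2 f : 'I_n.+1 -> 'I_m, injective f &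
    forall i j, I (xi (f i) - xi (f j)) -> i = j.
Proof.
move=> [B nB dB]; pose f i := enum_val (widen_ord nB i).
have f_inj : injective f.
  by move=> i j /enum_val_inj/(congr1 val)/= ij; apply: val_inj.
by exists f => // i j /dB ij; apply: f_inj; apply: ij; exact: enum_valP.
Qed.

Lemma natr_distinct_mod (p : set O) q k l : is_prime p -> prime q ->
  p q%:R -> (k < q)%N -> (l < q)%N -> p (k%:R - l%:R) -> k = l.
Proof.
move=> prime_p q_prime pq; wlog lk : k l / (l <= k)%N.
  move=> wl kq lq pkl; have [lk|/ltnW kl] := leqP l k; first exact: wl.
  by apply/esym/wl => //; apply: idealBC => //; case: prime_p.
move=> kq lq; rewrite -natrB //.
move=> /(natr_in_prime prime_p q_prime pq).
have [/eqP|kl] := posnP (k - l).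
  by rewrite subn_eq0 => kl _; apply/eqP; rewrite eqn_leq kl.
move=> /(dvdn_leq kl); rewrite leqNgt => /negP[].
by apply: leq_ltn_trans (leq_subr _ _) kq.
Qed.

(** ** Primes at which the points are too crowded *)

(** Let [B] be a maximal set of indices whose points are distinct modulo [p], and
    let [b] annihilate [p] modulo [q].  The product over [B] of the [X - xi i],
    multiplied by [b / q], is integral at each of the points, as each one is
    congruent to a point of [B].  Among the integers [0, ..., n], which are
    distinct modulo [p], one avoids the classes of [B], and there the value is
    not integral. *)
Lemma crowded_not_universal n m (xi : 'I_m -> O) (p : set O) (q : nat) :
  is_prime p -> prime q -> p q%:R -> (n < q)%N ->
  ~ distinct_mod n.+1 xi p ->
  ~ universal n [fset xi i | i : 'I_m]%fset.
Proof.
move=> prime_p q_prime pq nq crowded univ.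
have [idp p1 pM] := prime_p.
have p_neq0 : nonzero_ideal p.
  by exists q%:R => //; rewrite O_natr_eq0 -lt0n prime_gt0.
have [b [nb bp]] := annihilator_of_prime basis_omega prime_p q_prime pq.
have qK : q%:R != 0 :> K by rewrite charK0 -lt0n prime_gt0.
pose ok (B : {set 'I_m}) :=
  `[< forall i j, i \in B -> j \in B -> p (xi i - xi j) -> i = j >].
have /ex_maxset[B /maxsetP[/asboolP okB maxB]] : exists B, ok B.
  by exists finset.set0; apply/asboolP => i j; rewrite inE.
have cover k : exists2 i, i \in B & p (xi k - xi i).
  have [kB|nkB] := boolP (k \in B).
    by exists k => //; rewrite subrr; exact: ideal0.
  apply: contrapT => nex; suff kB : k \in B by rewrite kB in nkB.
  rewrite -(maxB (k |: B)%SET) ?subsetU1 ?setU11 //.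
  apply/asboolP => i j; rewrite !in_setU1.
  move=> /predU1P[->|iB] /predU1P[->|jB] // pij.
  - by exfalso; apply: nex; exists j.
  - by exfalso; apply: nex; exists i => //; exact: idealBC.
  - exact: okB.
have cardB : (#|B| <= n)%N.
  by rewrite leqNgt; apply/negP => nB; apply: crowded; exists B.
pose Q : {poly K} := \prod_(i in B) ('X - (val (xi i))%:P).
pose P := (val b / q%:R) *: Q.
have QE (x : O) : Q.[val x] = val (\prod_(i in B) (x - xi i)).
  rewrite horner_prod Oval_prod; apply: eq_bigr => i _.
  by rewrite hornerXsubC OvalB.
have szP : (size P <= n.+1)%N.
  apply: leq_trans (size_scale_leq _ _) _.
  by rewrite /Q -big_enum size_prod_XsubC -cardE ltnS.
have intP : forall x : O, P.[val x] \in algInt K.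
  apply/(univ P szP).
  move=> _ /imfsetP[k /= _ ->]; have [i iB pki] := cover k.
  have [y Hy] := bp _ pki.
  have -> : P.[val (xi k)] = val b / q%:R * val (xi k - xi i) *
      val (\prod_(j in B | j != i) (xi k - xi j)).
    by rewrite hornerZ QE (bigD1 i iB) OvalM mulrA.
  have -> : val b / q%:R * val (xi k - xi i) = val y.
    by rewrite mulrAC -OvalM Hy OvalM Oval_nat mulrAC divff // mul1r.
  by rewrite -OvalM OvalP.
have [k Hk] : exists k : 'I_n.+1, forall i, i \in B -> ~ p (k%:R - xi i).
  apply: contrapT => nex.
  have /choice[f Hf] : forall k : 'I_n.+1, exists i, i \in B /\ p (k%:R - xi i).
    move=> k; apply: contrapT => nk; apply: nex; exists k => i iB pi.
    by apply: nk; exists i.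
  have f_inj : injective f.
    move=> k l fkl; apply: val_inj; have [_ pk] := Hf k; have [_ pl] := Hf l.
    apply: (natr_distinct_mod prime_p q_prime pq).
    - exact: leq_trans (ltn_ord k) nq.
    - exact: leq_trans (ltn_ord l) nq.
    - by apply: idealB_trans pk _ => //; rewrite fkl; exact: idealBC.
  have : (#|[set f k | k in 'I_n.+1]%SET| <= #|B|)%N.
    by apply/subset_leq_card/fintype.subsetP => _ /imsetP[k _ ->]; case: (Hf k).
  rewrite card_imset // card_ord => /leq_trans/(_ cardB).
  by rewrite ltnn.
have [y Hy] := algIntP (intP k%:R).
pose c := \prod_(i in B) (k%:R - xi i).
have pc : p c.
  apply: nb; exists y; apply: val_inj; rewrite !OvalM Hy hornerZ QE -/c Oval_nat.
  by rewrite mulrA mulrCA divff // mulr1 mulrC.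
by have [i iB /Hk] := prime_prod prime_p pc; apply; case/andP: iB.
Qed.

End Universality.

(** * Primes of small norm *)

(** Thus [n + 1] consecutive integers are distinct modulo the power of [q] in
    [L`!].  If [q <= n] and [q ^ j <= L < q ^ j.+1], the first [j] terms of
    Legendre's formula are positive and the first one is at least two, so
    [q ^ j.+1], which exceeds [L], divides [L`!]. *)
Lemma ltn_prime_power_fact q n L : prime q -> (q %| L`!)%N -> (2 * n + 2 < L)%N ->
  (n < q ^ logn q L`!)%N.
Proof.
move=> q_prime qL nL; have q_gt1 := prime_gt1 q_prime.
have w1 : (0 < logn q L`!)%N by rewrite logn_gt0 mem_primes q_prime fact_gt0.
have [nq|qn] := ltnP n q.
  by apply: leq_trans nq _; rewrite -{1}(expn1 q) leq_exp2l.
have L_gt0 : (0 < L)%N by apply: leq_ltn_trans nL.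
have := trunc_log_bounds q_gt1 L_gt0; set j := trunc_log q L => /andP[qjL Lqj].
suff jw : (j < logn q L`!)%N.
  apply: leq_trans (leq_trans Lqj _); first by lia.
  by rewrite leq_exp2l.
have j_gt0 : (0 < j)%N.
  by rewrite trunc_log_gt0 q_gt1 /=; lia.
rewrite logn_fact // big_ltn; last by [].
have jL : (j < L.+1)%N by rewrite ltnS; apply: leq_trans (ltnW (ltn_expl j q_gt1)) qjL.
rewrite (@big_cat_nat _ _ _ j.+1) //=.
have jE : j.+1 = (2 + \sum_(2 <= k < j.+1) 1)%N.
  by rewrite sum_nat_const_nat muln1 addnC subnK.
rewrite {1}jE {jE}.
apply: leq_add; first by rewrite expn1 leq_divRL ?prime_gt0 //; lia.
apply: leq_trans (leq_addr _ _); rewrite big_nat_cond [X in (_ <= X)%N]big_nat_cond.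
apply: leq_sum => k; rewrite andbT => /andP[k2 kj].
rewrite divn_gt0 ?expn_gt0 ?prime_gt0 //.
by apply: leq_trans qjL; rewrite leq_exp2l.
Qed.

Lemma residue_countE (A : comNzRingType) (I : set A) n m (a : 'I_m -> A)
    (nm : (n.+1 <= m)%N) (y : A) :
  (forall i j : 'I_m, (i < n.+1)%N -> (j < n.+1)%N -> a i = a j -> i = j) ->
  residue_count I [fset a i | i : 'I_m & (i < n.+1)%N]%fset y =
    (\sum_(j < n.+1) `[< I (a (widen_ord nm j) - y)%R >])%N.
Proof.
move=> a_inj; rewrite /residue_count.
pose b (j : 'I_n.+1) := a (widen_ord nm j).
have b_inj : injective b.
  move=> i j /(a_inj (widen_ord nm i) (widen_ord nm j) (ltn_ord i) (ltn_ord j)).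
  move=> /(congr1 val)/= ij.
  exact: val_inj.
pose J := [pred j : 'I_n.+1 | `[< I (b j - y) >]].
have -> : [fset s in [fset a i | i : 'I_m & (i < n.+1)%N] | `[< I (s - y) >]]%fset
    = [fset b j | j in J]%fset.
  apply/fsetP => z; rewrite !inE /=; apply/andP/imfsetP => /=.
    move=> [/imfsetP[i /= ni zi] Iz]; rewrite inE in ni.
    have zb : z = b (Ordinal ni) by rewrite zi; congr a; apply: val_inj.
    exists (Ordinal ni); last exact: zb.
    by rewrite unfold_in /= -zb.
  move=> [j]; rewrite unfold_in /= => Ij ->; split => //.
  by apply/imfsetP; exists (widen_ord nm j) => //=; rewrite inE /= ltn_ord.
rewrite card_in_imfset /=; last by move=> i j _ _; exact: b_inj.
rewrite -cardE -sum1_card big_mkcond; apply: eq_bigr => j _.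
by rewrite unfold_in /= /b; case: asboolP.
Qed.

Section SmallPrimes.
Variables (K : fieldExtType rat) (d : nat).
Hypothesis dimK : \dim {:K} = d.
Variable omega : 'I_d -> ringOfIntegers K.
Hypothesis basis_omega : integral_basis omega.
Local Notation O := (ringOfIntegers K).

Variables (p : set O) (n L : nat) (a s : 'I_n.+1 -> O).
Hypotheses (prime_p : is_prime p) (p_neq0 : nonzero_ideal p).
Hypotheses (pL : p L`!%:R) (nL : (2 * n + 2 < L)%N).
Hypothesis a_unif : forall k x y, (0 < k)%N ->
  (\sum_j `[< ideal_exp p k (a j - x)%R >] <=
   (\sum_j `[< ideal_exp p k (a j - y)%R >]).+1)%N.
Hypothesis sa : forall j, principal L`!%:R (s j - a j).

(** Let [p ^ e] be the exact power of [p] dividing [L`!].  Up to [p ^ e] the points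
    [s] have the classes of the points [a], which meet each class about
    equally often.  There are more than [n] classes modulo [p ^ e], so no two
    of these [n + 1] points agree modulo [p ^ e], and beyond that power there
    is nothing to compare. *)
Lemma integral_at_small_prime (P : {poly K}) (x : O) : (size P <= n.+1)%N ->
  (forall i, P.[val (s i)] \in algInt K) ->
  exists2 D, ~ p D & val D * P.[val x] \in algInt K.
Proof.
have [idp p1 pM] := prime_p.
have idk k : is_ideal (ideal_exp p k) by exact: ideal_exp_ideal.
have [q q_prime pq] := residue_char_exists dimK basis_omega prime_p p_neq0.
have [pi [u [p_pi np_u pi_gen]]] :=
  uniformizer_exists basis_omega prime_p q_prime pq.
pose v := valuation p pi.
have expE z k : z != 0 -> ideal_exp p k z <-> (k <= v z)%N.
  exact: (ideal_expE dimK basis_omega prime_p p_neq0 p_pi np_u pi_gen).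
have v_nat k : (0 < k)%N -> v k%:R = (logn q k * v q%:R)%N.
  move=> k0; have [k' qk' kE] := pfactor_coprime q_prime k0.
  have npk' : ~ p k'%:R.
    move=> /(natr_in_prime prime_p q_prime pq); apply/negP.
    by rewrite -prime_coprime.
  have q0 : q%:R != 0 :> O by rewrite O_natr_eq0 -lt0n prime_gt0.
  have [D [y [npD npy Dq]]] :=
    valuationP dimK basis_omega prime_p p_neq0 p_pi np_u pi_gen q0.
  apply: (valuation_eq prime_p p_neq0 p_pi np_u pi_gen).
  exists (D ^+ logn q k), (y ^+ logn q k * k'%:R); split.
  - by move=> /(primeX prime_p).
  - by move=> /pM[/(primeX prime_p)|].
  - rewrite {2}kE natrM natrX mulrCA -exprMn Dq exprMn -exprM mulnC.
    by rewrite mulrC -mulrA.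
clearbody v.
have L0 : L`!%:R != 0 :> O by rewrite O_natr_eq0 -lt0n fact_gt0.
have [e eE] : exists e, e = v L`!%:R by exists (v L`!%:R).
have e_gt0 : (0 < e)%N.
  by rewrite eE; apply/(expE _ _ L0); exact: (ideal_exp_X 1 pL).
have v_q : (0 < v q%:R)%N.
  have q0 : q%:R != 0 :> O by rewrite O_natr_eq0 -lt0n prime_gt0.
  by apply/(expE _ _ q0); apply: (ideal_exp_X 1 pq).
have natr_dist k l : (k < n.+1)%N -> (l < n.+1)%N ->
    ideal_exp p e (k%:R - l%:R) -> k = l.
  wlog lk : k l / (l < k)%N.
    move=> wl kn ln pkl; have [lk|kl|//] := ltngtP l k; first exact: wl.
    by apply/esym/wl => //; exact: idealBC.
  move=> kn _; rewrite -natrB 1?ltnW //.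
  have kl : (0 < k - l)%N by rewrite subn_gt0.
  have kl0 : (k - l)%:R != 0 :> O by rewrite O_natr_eq0 -lt0n.
  move=> /(expE _ _ kl0); rewrite eE (v_nat _ kl) (v_nat _ (fact_gt0 L)).
  rewrite (leq_pmul2r v_q) => le.
  have := @ltn_prime_power_fact q n L q_prime _ nL.
  move=> /(_ (proj1 (natr_in_prime prime_p q_prime pq _) pL)) lt.
  have : (q ^ logn q L`! <= k - l)%N.
    by apply: dvdn_leq => //; rewrite pfactor_dvdn.
  by move=> /(leq_trans lt); rewrite ltnNge leq_subLR (leq_trans _ (leq_addl _ _)).
have a_dist i j : ideal_exp p e (a i - a j) -> i = j.
  move=> aij; apply/eqP/negPn/negP => nij.
  have hit (x0 : O) : exists k, ideal_exp p e (a k - x0).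
    apply: contrapT => nk; have := a_unif (a i) x0 e_gt0.
    rewrite [X in (_ <= X.+1)%N]big1 => [|k _]; last first.
      by rewrite asboolF // => ak; apply: nk; exists k.
    rewrite (bigD1 i) //= (bigD1 j) 1?eq_sym //= !asboolT //.
      by exact: idealBC.
    by rewrite subrr; exact: ideal0.
  have /choice[f Hf] : forall k : 'I_n.+1, exists l, ideal_exp p e (a l - k%:R).
    by move=> k; exact: hit.
  have f_inj : injective f.
    move=> k l fkl; apply/val_inj/natr_dist; rewrite ?ltn_ord //.
    by apply: idealB_trans (Hf l) => //; rewrite -fkl; exact: idealBC.
  have [g fK gK] := injF_bij f_inj.
  move/eqP: nij; apply; rewrite -(gK i) -(gK j); congr f.
  apply/val_inj/natr_dist; rewrite ?ltn_ord //.
  have := Hf (g i); have := Hf (g j); rewrite !gK => aj ai.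
  apply: idealB_trans (idealB_trans _ aij aj) => //.
  exact: idealBC.
have sa_exp j k : (k <= e)%N -> ideal_exp p k (s j - a j).
  move=> ke; have [y ->] := sa j; apply: ideal_mulr => //.
  by apply/(expE _ _ L0); rewrite -eE.
have s_dist i j : ideal_exp p e (s i - s j) -> i = j.
  move=> sij; apply: a_dist; have := sa_exp i e (leqnn e); have := sa_exp j e (leqnn e).
  move=> sj si; apply: (idealB_trans _ _ (idealB_trans _ sij sj)) => //.
  exact: idealBC.
have s_inj : injective s.
  by move=> i j sij; apply: s_dist; rewrite sij subrr; exact: ideal0.
move=> szP Ps.
have [[i ->]|xs] := pselect (exists i, x = s i).
  by exists 1 => //; rewrite rmorph1 mul1r; exact: Ps.
apply: (local_interpolation prime_p s_inj szP Ps) => i.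
apply: (count_prod_dvd dimK basis_omega prime_p p_neq0 p_pi np_u pi_gen) => //.
  by move=> j; apply/eqP => xsj; apply: xs; exists j.
move=> k k_gt0; have [ke|ek] := leqP k e; last first.
  rewrite big1 // => j ji; rewrite asboolF // => sij.
  have /s_dist ij : ideal_exp p e (s i - s j).
    by apply: ideal_exp_le sij => //; exact: ltnW.
  by rewrite ij eqxx in ji.
have asE j y : `[< ideal_exp p k (a j - y) >] = `[< ideal_exp p k (y - s j) >].
  apply/asbool_equiv_eq; split => H.
    apply: idealBC => //; apply: idealB_trans H => //; exact: sa_exp.
  have := idealB_trans (idk k) H (sa_exp j k ke); exact: idealBC.
have := a_unif (s i) x k_gt0.
under eq_bigr do rewrite asE.
under [X in (_ <= X.+1)%N -> _]eq_bigr do rewrite asE.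
rewrite (bigD1 i) //= [X in (_ <= X.+1)%N -> _](bigD1 i) //=.
rewrite subrr asboolT; last exact: ideal0.
case: asboolP => [xi _|_]; last by rewrite add0n add1n ltnS.
apply: leq_sum => j _; rewrite leq_eqVlt; apply/orP; left; apply/eqP; congr nat_of_bool.
apply/asbool_equiv_eq; split => H; first exact: idealB_trans xi H.
by apply: idealB_trans H => //; exact: idealBC.
Qed.
End SmallPrimes.

(** * Universality as a condition at large primes *)

Section LargePrimes.
Variables (K : fieldExtType rat) (d : nat).
Hypothesis dimK : \dim {:K} = d.
Variable omega : 'I_d -> ringOfIntegers K.
Hypothesis basis_omega : integral_basis omega.
Local Notation O := (ringOfIntegers K).

Definition shifted n L (a x : 'I_(n + d) -> O) i : O := a i + L`!%:R * x i.

Definition crowded n L (a x : 'I_(n + d) -> O) (q : nat) :=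
  exists2 p : set O, is_prime p /\ p q%:R & ~ distinct_mod n.+1 (shifted L a x) p.

Definition crowded_above n L (a x : 'I_(n + d) -> O) (Y : nat) :=
  exists2 q, prime q /\ (Y < q)%N & crowded L a x q.

(** Integrality of [P] at [x0] is tested one prime at a time.  If [p] contains
    [L`!], the points keep the classes of the [a i], and these were chosen
    well: equally distributed when the norm of [p] is at most [L], and with
    enough distinct classes otherwise. *)
Lemma universal_random_setP n L (a x : 'I_(n + d) -> O) :
  (0 < d)%N -> (maxn (n + d) (2 * n + 2) < L)%N -> admissible L a ->
  universal n (random_set L a x) <->
  (forall p : set O, is_prime p -> nonzero_ideal p -> ~ p L`!%:R ->
     distinct_mod n.+1 (shifted L a x) p).
Proof.
rewrite gtn_max => d_gt0 /andP[ndL nL] [[_ a_large] a_inj a_unif].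
split=> [univ p prime_p p_neq0 npL|dist P szP].
  have [q q_prime pq] := residue_char_exists dimK basis_omega prime_p p_neq0.
  apply: contrapT => crowded.
  apply: (crowded_not_universal basis_omega prime_p q_prime pq _ crowded univ).
  have Lq : (L < q)%N.
    rewrite ltnNge; apply/negP => qL; apply: npL.
    by apply/(natr_in_prime prime_p q_prime pq); apply: dvdn_fact; rewrite prime_gt0.
  by apply: leq_ltn_trans Lq; lia.
split=> [PO x0 _|PS x0]; first exact: PO.
apply: (integral_of_local dimK basis_omega) => p prime_p p_neq0.
have [idp p1 pM] := prime_p.
have Pxi i : P.[val (shifted L a x i)] \in algInt K.
  by apply: PS; apply/imfsetP; exists i.
have use_distinct : distinct_mod n.+1 (shifted L a x) p ->
    exists2 D : O, ~ p D & val D * P.[val x0] \in algInt K.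
  move=> /distinct_mod_seq[f f_inj f_dist].
  have H := @local_interpolation_distinct K p n (shifted L a x \o f) P x0
    prime_p f_dist szP.
  by apply: H => i; exact: Pxi.
have [pL|npL] := pselect (p L`!%:R); last exact/use_distinct/dist.
have [P' P'p] := prime_idealrP prime_p.
have [P'L|nP'L] := pselect (ideal_norm_le P' L); last first.
  apply: use_distinct.
  have [||B nB dB] := a_large P' _ _ nP'L.
  - by rewrite P'p.
  - by have : [set` P'] L`!%:R by rewrite P'p.
  exists B => // i j iB jB pij; apply: dB => //; rewrite P'p.
  have -> : a i - a j = shifted L a x i - shifted L a x j + L`!%:R * (x j - x i).
    by rewrite /shifted; ring.
  by apply: idealD => //; exact: ideal_mulr.
have nm : (n.+1 <= n + d)%N by rewrite -addn1 leq_add2l.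
pose w := widen_ord nm.
apply: (@integral_at_small_prime _ _ dimK _ basis_omega p n L (a \o w)
  (shifted L a x \o w)) => //.
- move=> k y z k0; have := a_unif P' k _ P'L k0 y z; rewrite P'p => /(_ p_neq0).
  rewrite !(residue_countE _ nm) //.
  pose S t := (\sum_(j < n.+1) `[< ideal_exp p k (a (w j) - t)%R >])%N.
  rewrite -[X in (Posz X - _)%R \in _]/(S y) -[X in (_ - Posz X)%R \in _]/(S z).
  move=> yz; suff : (S y <= (S z).+1)%N by [].
  by move: yz; rewrite !inE => /or3P[] /eqP; lia.
- by move=> j; exists (x (w j)); rewrite /= /shifted addrC addKr.
- by move=> i; exact: Pxi.
Qed.

(** Elements that vanish at all but one of several primes above [q] are
    linearly independent modulo [q], so there are at most [d] such primes. *)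
Lemma card_primes_above q g (p : 'I_g -> set O) : prime q -> injective p ->
  (forall i, is_prime (p i) /\ p i q%:R) -> (g <= d)%N.
Proof.
move=> q_prime p_inj pP; have q_gt0 := prime_gt0 q_prime.
have idp i : is_ideal (p i) by case: (pP i) => [[]].
have sep i j : j != i -> exists2 y, p j y & ~ p i y.
  move=> ji; apply: contrapT => nex.
  have sub_ji : p j `<=` p i.
    by move=> y pjy; apply: contrapT => npiy; apply: nex; exists y.
  move/eqP: ji; apply; apply/p_inj/seteqP; split => // z piz.
  apply: contrapT => npjz; have [prime_j pjq] := pP j.
  have pj0 : nonzero_ideal (p j).
    by exists q%:R => //; rewrite O_natr_eq0 -lt0n.
  have [E pjE] := inverse_mod_prime dimK basis_omega prime_j pj0 npjz.
  have [[_ pi1 _] _] := pP i; apply: pi1; rewrite -(subrK (z * E) 1).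
  by apply: idealD => //; [exact: sub_ji|exact: ideal_mulr].
have /choice[x Hx] : forall i, exists x, ~ p i x /\ forall j, j != i -> p j x.
  move=> i; have /choice[y Hy] : forall j, exists y, j != i -> p j y /\ ~ p i y.
    move=> j; have [->|ji] := eqVneq j i; first by exists 0.
    by have [y ? ?] := sep i j ji; exists y.
  exists (\prod_(j | j != i) y j); split.
    have [prime_i _] := pP i.
    by move=> /(prime_prod prime_i)[j /andP[_ /Hy[_]]].
  move=> j ji; rewrite (bigD1 j ji); apply: ideal_mulr => //.
  by have [] := Hy j ji.
pose f (c : {ffun 'I_g -> 'I_q}) := residue basis_omega q_gt0
  (\sum_i (c i : nat)%:R * x i).
have f_inj : injective f.
  move=> b c /residueP[y Hy]; apply/ffunP => i; apply: val_inj.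
  have [prime_i piq] := pP i; have [npix _] := Hx i.
  have : p i (((b i : nat)%:R - (c i : nat)%:R) * x i).
    have -> : ((b i : nat)%:R - (c i : nat)%:R) * x i = q%:R * y -
        \sum_(j | j != i) ((b j : nat)%:R - (c j : nat)%:R) * x j.
      rewrite -Hy -sumrB (bigD1 i) //= -mulrBl [X in _ + X - _](eq_bigr
        (fun j => ((b j : nat)%:R - (c j : nat)%:R) * x j)) ?addrK //.
      by move=> j _; rewrite mulrBl.
    apply: idealB => //; first exact: ideal_mulr.
    apply: ideal_sum => // j ji; apply: ideal_mull => //.
    by have [_] := Hx j; apply; rewrite eq_sym.
  have [_ _ piM] := prime_i.
  by move=> /piM[/(natr_distinct_mod prime_i q_prime piq)|//]; apply.
have := leq_card f f_inj; rewrite !card_ffun !card_ord.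
by rewrite leq_exp2l // prime_gt1.
Qed.

(** ** A small integer multiple *)

Definition mulmat (z : O) : 'M[int]_d :=
  \matrix_(i, j) coo basis_omega (z * omega i) j.

Lemma mulmatE z i : z * omega i = \sum_j omega j *~ mulmat z i j.
Proof.
rewrite -[LHS](cooK basis_omega); apply: eq_bigr => j _.
by rewrite mxE.
Qed.

Lemma omega_indep (b c : 'I_d -> int) :
  \sum_j omega j *~ b j = \sum_j omega j *~ c j -> b =1 c.
Proof.
move=> bc i; have := combK basis_omega b i.
by rewrite /comb bc -/(comb omega c) combK.
Qed.

Lemma mulmatM z w : mulmat (z * w) = mulmat z *m mulmat w.
Proof.
apply/matrixP => i; apply: omega_indep; rewrite -mulmatE mulrAC mulmatE.
rewrite mulr_suml.
under eq_bigr do rewrite mulrzAl mulrC mulmatE.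
under [RHS]eq_bigr do rewrite mxE mulrz_sumr.
rewrite [RHS]exchange_big; apply: eq_bigr => j _; rewrite mulrz_suml.
by apply: eq_bigr => k _; rewrite mulrC mulrzA.
Qed.

Lemma mulmat_nat m : mulmat m%:R = (m%:Z)%:M.
Proof.
apply/matrixP => i; apply: omega_indep; rewrite -mulmatE.
rewrite (bigD1 i) //= big1 ?addr0 => [|j ji].
  by rewrite mxE eqxx mulr1n mulr_natl.
by rewrite mxE eq_sym (negPf ji) mulr0n mulr0z.
Qed.

Lemma det_mulmat_neq0 z : z != 0 -> \det (mulmat z) != 0.
Proof.
move=> /(integer_multiple dimK basis_omega)[m m_gt0 [y Hy]].
have : \det (mulmat (z * y)) != 0.
  by rewrite Hy mulmat_nat det_scalar expf_neq0 // eqz_nat -lt0n.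
by rewrite mulmatM det_mulmx mulf_eq0 negb_or => /andP[].
Qed.

Lemma det_mulmat_multiple z : exists y, z * y = (\det (mulmat z))%:~R.
Proof.
have adjE k : z * (\sum_i omega i *~ (\adj (mulmat z)) k i) =
    omega k *~ \det (mulmat z).
  transitivity (\sum_j omega j *~ (\adj (mulmat z) *m mulmat z) k j).
    rewrite mulr_sumr; under eq_bigr do rewrite mulrzAr mulmatE.
    under [RHS]eq_bigr do rewrite mxE mulrz_sumr.
    rewrite [RHS]exchange_big; apply: eq_bigr => j _; rewrite mulrz_suml.
    by apply: eq_bigr => i _; rewrite mulrC mulrzA.
  rewrite mul_adj_mx (bigD1 k) //= big1 ?addr0 => [|j jk].
    by rewrite mxE eqxx mulr1n.
  by rewrite mxE eq_sym (negPf jk) mulr0n mulr0z.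
exists (\sum_k (\sum_i omega i *~ (\adj (mulmat z)) k i) *~ coo basis_omega 1 k).
rewrite mulr_sumr; under eq_bigr do rewrite mulrzAr adjE mulrzAC.
by rewrite -mulrz_suml -/(comb omega _) cooK.
Qed.

(** The determinant of multiplication by [z] is a multiple of [z], and a form of
    degree [d] in the coordinates of [z]. *)
Lemma small_multiple : exists C : nat, forall (z : O) (H : nat), z != 0 ->
  (forall i, `|coo basis_omega z i|%N <= H)%N ->
  exists N y, [/\ (0 < N)%N, (N <= C * H ^ d)%N & z * y = N%:R].
Proof.
pose B := (\sum_i \sum_j \sum_k `|coo basis_omega (omega k * omega i)%R j|)%N.
exists (d`! * B ^ d)%N => z H z0 zH; exists `|\det (mulmat z)|%N.
have [y Hy] := det_mulmat_multiple z.
exists (if 0 <= \det (mulmat z) then y else - y); split.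
- by rewrite absz_gt0 det_mulmat_neq0.
- have entry i j : `|mulmat z i j| <= (B * H)%N%:Z.
    have -> : mulmat z i j =
        \sum_k coo basis_omega z k * coo basis_omega (omega k * omega i) j.
      rewrite mxE -{1}(cooK basis_omega z) mulr_suml.
      rewrite -[RHS](combK basis_omega (fun j => \sum_k coo basis_omega z k *
        coo basis_omega (omega k * omega i) j)).
      congr (coo _ _ j); rewrite /comb.
      under [RHS]eq_bigr do rewrite mulrz_sumr.
      rewrite [RHS]exchange_big; apply: eq_bigr => k _.
      rewrite mulrzAl -{1}(cooK basis_omega (omega k * omega i)) mulrz_suml.
      by apply: eq_bigr => l _; rewrite [_ * coo _ _ l]mulrC mulrzA.
    apply: le_trans (ler_norm_sum _ _ _) _.
    apply: (@le_trans _ _ (\sum_k H%:Z * `|coo basis_omega (omega k * omega i) j|)).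
      by apply: ler_sum => k _; rewrite normrM ler_wpM2r // -abszE lez_nat.
    rewrite -mulr_sumr mulnC PoszM ler_wpM2l //.
    under eq_bigr do rewrite -abszE.
    rewrite -(big_morph Posz PoszD (erefl _)) lez_nat /B.
    rewrite [X in (_ <= X)%N](bigD1 i) //= [X in (_ <= X + _)%N](bigD1 j) //=.
    by rewrite -addnA leq_addr.
  rewrite -lez_nat abszE; apply: le_trans (ler_norm_sum _ _ _) _.
  apply: (@le_trans _ _ (\sum_(s : 'S_d) (B * H)%N%:Z ^+ d)).
    apply: ler_sum => s _; rewrite normrM normr_sign mul1r normr_prod.
    have -> : (B * H)%N%:Z ^+ d = \prod_(i < d) (B * H)%N%:Z.
      by rewrite prodr_const card_ord.
    by apply: ler_prod => i _; rewrite normr_ge0 entry.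
  rewrite sumr_const card_Sn -mulnA -expnMn.
  have powE : ((B * H) ^ d)%N%:Z = (B * H)%N%:Z ^+ d by rewrite -!natz natrX.
  by rewrite [leRHS]PoszM powE -mulr_natl natz.
- rewrite -[_%:R]/((Posz _)%:~R) abszE; case: ger0P => h.
    by rewrite Hy.
  by rewrite mulrN Hy mulrNz.
Qed.

End LargePrimes.

(** * Binomial coefficients in residue classes *)

Lemma leq_bin_up m k : (k.*2 < m)%N -> ('C(m, k) <= 'C(m, k.+1))%N.
Proof.
move=> km; rewrite -(leq_pmul2l (ltn0Sn k)) mul_bin_left leq_mul2r.
by apply/orP; right; lia.
Qed.

Lemma leq_bin_down m k : (m <= k.*2.+1)%N -> ('C(m, k.+1) <= 'C(m, k))%N.
Proof.
move=> mk; rewrite -(leq_pmul2l (ltn0Sn k)) mul_bin_left leq_mul2r.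
by apply/orP; right; lia.
Qed.

Lemma central_bin_even m : ('C(m.*2, m) ^ 2 * m.*2.+1 <= 16 ^ m)%N.
Proof.
elim: m => [|m IH]; first by rewrite bin0.
have E : (m.+1 * 'C(m.+1.*2, m.+1) = m.*2.+1 * 'C(m.*2, m) * 2)%N.
  apply/eqP; rewrite -(eqn_pmul2l (ltn0Sn m)); apply/eqP.
  rewrite doubleS -mul_bin_diag.
  have := mul_bin_down m.*2.+1 m; rewrite /= => E.
  have -> : (m.+1 * (m.*2.+2 * 'C(m.*2.+1, m)) =
             m.*2.+2 * (m.+1 * 'C(m.*2.+1, m)))%N by rewrite mulnCA.
  have -> : (m.+1 * 'C(m.*2.+1, m) = m.*2.+1 * 'C(m.*2, m))%N.
    by rewrite E; congr (_ * _)%N; lia.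
  by rewrite -[m.*2.+2]/(m.+1.*2) -muln2; ring.
rewrite -(leq_pmul2l (ltn0Sn m)) -(leq_pmul2l (ltn0Sn m)).
have -> : (m.+1 * (m.+1 * ('C(m.+1.*2, m.+1) ^ 2 * m.+1.*2.+1)) =
   'C(m.*2, m) ^ 2 * m.*2.+1 * (4 * (m.*2.+1 * m.*2.+3)))%N.
  transitivity ((m.+1 * 'C(m.+1.*2, m.+1)) ^ 2 * m.*2.+3)%N.
    by rewrite doubleS; ring.
  by rewrite E; ring.
have -> : (m.+1 * (m.+1 * 16 ^ m.+1) = 16 ^ m * (16 * (m.+1 * m.+1)))%N.
  by rewrite expnS; ring.
apply: leq_mul => //; rewrite -muln2; nia.
Qed.

(** Equivalently, the central binomial probability is at most [M ^ (-1/2)]. *)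
Lemma central_bin M : ('C(M, M./2) ^ 2 * M <= 4 ^ M)%N.
Proof.
have [M2|M2] : M = M./2.*2 \/ M = M./2.*2.+1.
  by have := odd_double_half M; case: (odd M) => <-; [right|left];
    rewrite /= ?uphalf_double ?doubleK.
  set m := M./2 in M2 *; rewrite M2.
  apply: leq_trans (_ : 'C(m.*2, m) ^ 2 * m.*2.+1 <= _)%N.
    by rewrite leq_mul2l leqnSn orbT.
  by apply: leq_trans (central_bin_even m) _; rewrite -muln2 mulnC expnM.
set m := M./2 in M2 *; rewrite M2.
have E : ('C(m.+1.*2, m.+1) = 'C(m.*2.+1, m) * 2)%N.
  apply/eqP; rewrite -(eqn_pmul2l (ltn0Sn m)); apply/eqP.
  rewrite doubleS -mul_bin_diag /=; rewrite -[m.*2.+2]/(m.+1.*2) -muln2; ring.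
have := central_bin_even m.+1; rewrite E doubleS.
have -> : (4 ^ m.*2.+1 = 4 * 16 ^ m)%N by rewrite expnS -mul2n expnM.
rewrite [(16 ^ _)%N]expnS expnMn -!muln2 (_ : 2 ^ 2 = 4)%N //.
move: ('C(_, _) ^ 2)%N (16 ^ m)%N => y X. nia.
Qed.

Lemma central_bin_sqrt M r : (r ^ 2 <= M)%N -> ('C(M, M./2) * r <= 2 ^ M)%N.
Proof.
move=> rM; rewrite -leq_sqr expnMn -expnM [(M * 2)%N]mulnC expnM.
by apply: leq_trans (central_bin M); rewrite leq_mul2l rM orbT.
Qed.

Section BinomialClasses.
Variable R : realFieldType.
Implicit Types (f : nat -> R).

(** The binomial coefficients increase up to the middle one and decrease
    afterwards, which bounds their total variation. *)
Lemma total_variation_bin M N :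
  \sum_(0 <= k < N) `|'C(M, k.+1)%:R - 'C(M, k)%:R : R| <= 2 * 'C(M, M./2)%:R.
Proof.
pose f k : R := 'C(M, k)%:R; set h := M./2.
have up n : (n <= h)%N -> \sum_(0 <= k < n) `|f k.+1 - f k| = f n - f 0%N.
  elim: n => [|n IH] nh; first by rewrite big_geq // subrr.
  rewrite big_nat_recr //= IH 1?ltnW // ger0_norm; first by rewrite addrC subrKA.
  by rewrite subr_ge0 ler_nat leq_bin_up //; lia.
have down n : \sum_(0 <= k < h + n) `|f k.+1 - f k| = 2 * f h - f 0%N - f (h + n)%N.
  elim: n => [|n IH]; first by rewrite addn0 up //; ring.
  rewrite addnS big_nat_recr //= IH ler0_norm; first by ring.
  by rewrite subr_le0 ler_nat leq_bin_down //; lia.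
have f_ge0 k : 0 <= f k by exact: ler0n.
rewrite -/(f h); have [Nh|/ltnW hN] := leqP N h; last first.
  have := down (N - h)%N; rewrite subnKC // => ->.
  by have := f_ge0 0%N; have := f_ge0 N; lra.
rewrite up //; have := f_ge0 0%N; have := f_ge0 h.
have : f N <= f h; last by lra.
have := up h (leqnn h); rewrite (@big_cat_nat _ _ _ N) //= up // => E.
have : 0 <= \sum_(N <= k < h) `|f k.+1 - f k| by apply: sumr_ge0.
by move: E; set s := \sum_(N <= k < h) _; lra.
Qed.

(** On each block of length [Q] the two terms differ by no more than the variation
    of [f] on that block. *)
Lemma class_sums_close f Q J c c' : (c < Q)%N -> (c' < Q)%N ->
  `|\sum_(0 <= j < J) f (j * Q + c)%N - \sum_(0 <= j < J) f (j * Q + c')%N| <=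
  \sum_(0 <= k < J * Q) `|f k.+1 - f k|.
Proof.
wlog cc' : c c' / (c <= c')%N => [wl cQ c'Q|_ c'Q].
  have [cc'|/ltnW c'c] := leqP c c'; first exact: wl.
  by rewrite distrC; exact: wl.
rewrite -sumrB; apply: le_trans (ler_norm_sum _ _ _) _.
rewrite big_nat_mul; apply: ler_sum => j _.
rewrite distrC -(telescope_sumr _ (leq_add (leqnn (j * Q)%N) cc')).
apply: le_trans (ler_norm_sum _ _ _) _.
rewrite [leRHS](@big_cat_nat _ _ _ (j * Q + c)%N) ?leq_addr //=; last first.
  by rewrite mulSn addnC leq_add2r ltnW // (leq_ltn_trans cc').
rewrite [X in _ + X](@big_cat_nat _ _ _ (j * Q + c')%N) ?leq_add2l //=; last first.
  by rewrite mulSn addnC leq_add2r ltnW.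
rewrite addrCA lerDl; apply: addr_ge0; exact: sumr_ge0.
Qed.

Section ClassCount.
Variables (M Q : nat).
Hypothesis Q_gt0 : (0 < Q)%N.

Definition class_count c := #|[set A : {set 'I_M} | (#|A| %% Q == c)%N]%SET|.

Lemma class_countE c : (c < Q)%N ->
  class_count c = (\sum_(0 <= j < M.+1) 'C(M, j * Q + c))%N.
Proof.
move=> cQ; rewrite /class_count -sum1_card big_mkord.
have divM (A : {set 'I_M}) : (#|A| %/ Q < M.+1)%N.
  by rewrite ltnS (leq_trans (leq_div _ _)) // (leq_trans (max_card _)) ?card_ord.
rewrite (partition_big (fun A => Ordinal (divM A)) predT) //=.
apply: eq_bigr => j _; rewrite sum1_card -[X in 'C(X, _)](card_ord M) -card_draws.
apply: eq_card => A; rewrite unfold_in /= !finset.in_set -val_eqE /=.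
apply/andP/eqP => [[/eqP AQ /eqP Aj]|->].
  by rewrite (divn_eq #|A| Q) AQ Aj.
by rewrite modnMDl modn_small // divnMDl // divn_small // addn0.
Qed.

Lemma card_sets : #|{set 'I_M}| = (2 ^ M)%N.
Proof. by rewrite -cardsT -powersetT card_powerset cardsT card_ord. Qed.

Lemma sum_class_count : (\sum_(c < Q) class_count c = 2 ^ M)%N.
Proof.
rewrite -card_sets -sum1_card.
rewrite (partition_big (fun A : {set 'I_M} => Ordinal (ltn_pmod #|A| Q_gt0)) predT) //=.
apply: eq_bigr => c _; rewrite /class_count -sum1_card.
by apply: eq_bigl => A; rewrite inE -val_eqE.
Qed.

(** All class sums are within the total variation of each other, hence of
    their mean. *)
Lemma class_frequency r c : (0 < r)%N -> (r ^ 2 <= M)%N -> (c < Q)%N ->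
  `|(class_count c)%:R / (2 ^ M)%:R - Q%:R^-1 : R| <= 2 / r%:R.
Proof.
move=> r0 rM cQ; have Q0 : (0 : R) < Q%:R by rewrite ltr0n.
have r0' : (0 : R) < r%:R by rewrite ltr0n.
have N0 : (0 : R) < (2 ^ M)%:R by rewrite ltr0n expn_gt0.
have countE b : (b < Q)%N ->
    (class_count b)%:R = \sum_(0 <= j < M.+1) 'C(M, j * Q + b)%:R :> R.
  by move=> /class_countE ->; rewrite natr_sum.
have step : `|Q%:R * (class_count c)%:R - (2 ^ M)%:R : R| <=
    Q%:R * (2 * 'C(M, M./2)%:R).
  have -> : Q%:R * (class_count c)%:R - (2 ^ M)%:R =
     \sum_(b < Q) ((class_count c)%:R - (class_count b)%:R) :> R.
    rewrite sumrB sumr_const card_ord -natr_sum sum_class_count.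
    by rewrite mulr_natl.
  apply: le_trans (ler_norm_sum _ _ _) _.
  have -> : Q%:R * (2 * 'C(M, M./2)%:R) = \sum_(b < Q) 2 * 'C(M, M./2)%:R :> R.
    by rewrite sumr_const card_ord mulr_natl.
  apply: ler_sum => b _.
  rewrite !countE //.
  apply: le_trans (@class_sums_close (fun k => 'C(M, k)%:R) Q M.+1 c b cQ
    (ltn_ord b)) _.
  exact: total_variation_bin.
have -> : (class_count c)%:R / (2 ^ M)%:R - Q%:R^-1 =
    (Q%:R * (class_count c)%:R - (2 ^ M)%:R) / (Q%:R * (2 ^ M)%:R) :> R.
  by field; rewrite !gt_eqF.
rewrite normrM [X in _ * X]gtr0_norm; last by rewrite invr_gt0 mulr_gt0.
rewrite ler_pdivrMr ?mulr_gt0 //; apply: le_trans step _.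
have -> : 2 / r%:R * (Q%:R * (2 ^ M)%:R) = Q%:R * (2 * ((2 ^ M)%:R / r%:R)) :> R.
  by ring.
apply: ler_wpM2l; first exact: ltW.
apply: ler_wpM2l; first by [].
by rewrite ler_pdivlMr // -natrM ler_nat central_bin_sqrt.
Qed.

End ClassCount.
End BinomialClasses.

(** * Uniform laws on finite sets *)

Section Frequency.
Variable R : realFieldType.

Definition freq (T : finType) (E : pred T) : R := #|E|%:R / #|T|%:R.

Lemma freqE (T : finType) (E : pred T) :
  freq E = (\sum_t (E t)%:R) / #|T|%:R.
Proof.
rewrite /freq -sum1_card natr_sum big_mkcond; congr (_ / _).
by apply: eq_bigr => t _; rewrite unfold_in; case: (E t).
Qed.

Lemma freq_ge0 (T : finType) (E : pred T) : 0 <= freq E.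
Proof. by rewrite divr_ge0 ?ler0n. Qed.

Lemma freq_le1 (T : finType) (E : pred T) : freq E <= 1.
Proof.
rewrite /freq; have [->|T0] := posnP #|T|; first by rewrite invr0 mulr0 ler01.
by rewrite ler_pdivrMr ?ltr0n // mul1r ler_nat max_card.
Qed.

Lemma eq_freq (T : finType) (E F : pred T) : E =1 F -> freq E = freq F.
Proof. by move=> EF; rewrite !freqE; under eq_bigr do rewrite EF. Qed.

Lemma freq_cover (T : finType) (I : Type) (r : seq I) (E : pred T)
    (F : I -> pred T) :
  (forall t, E t -> has (F^~ t) r) -> freq E <= \sum_(i <- r) freq (F i).
Proof.
move=> EF; under [leRHS]eq_bigr do rewrite freqE.
rewrite freqE -mulr_suml ler_wpM2r ?invr_ge0 ?ler0n //.
rewrite exchange_big; apply: ler_sum => t _ /=.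
rewrite -natr_sum ler_nat; case Et: (E t) => //.
have := EF t Et; elim: r {EF} => [//|i r IH] /=; rewrite big_cons.
by case: (F i t) => //= /IH; rewrite add0n.
Qed.

Lemma freq_sub (T : finType) (E F : pred T) :
  (forall t, E t -> F t) -> freq E <= freq F.
Proof.
move=> EF; have := @freq_cover T unit [:: tt] E (fun _ => F).
by rewrite big_seq1; apply => t /EF /= ->.
Qed.

Lemma freqU (T : finType) (E F : pred T) :
  freq (fun t => E t || F t) <= freq E + freq F.
Proof.
have := @freq_cover T bool [:: true; false] (fun t => E t || F t)
  (fun b => if b then E else F).
by rewrite big_cons big_seq1; apply => t /=; rewrite orbF.
Qed.

Lemma freq_bij (T T' : finType) (h : T' -> T) (E : pred T) : bijective h ->
  freq E = freq (fun t => E (h t)).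
Proof.
move=> bh; rewrite !freqE (bij_eq_card bh); congr (_ / _).
by rewrite (reindex h) //; exact: onW_bij.
Qed.

Section Families.
Variables (I T : finType).

Definition update (t : {ffun I -> T}) i x : {ffun I -> T} :=
  [ffun j => if j == i then x else t j].

Lemma update_same t i x : update t i x i = x.
Proof. by rewrite ffunE eqxx. Qed.

Lemma update_other t i x j : j != i -> update t i x j = t j.
Proof. by rewrite ffunE => /negPf ->. Qed.

(** Exchanging the [i]-th coordinate with an independent value is an involution. *)
Lemma freq_resample (E : pred {ffun I -> T}) i :
  freq E = (\sum_t freq (fun x => E (update t i x))) / #|{ffun I -> T}|%:R.
Proof.
have [T0|T_gt0] := posnP #|T|.
  rewrite freqE; congr (_ / _); apply: eq_bigr => t _; exfalso.
  by have := card0_eq T0 (t i).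
rewrite freqE; congr (_ / _); under [RHS]eq_bigr do rewrite freqE.
rewrite -mulr_suml; apply: (mulIf (_ : #|T|%:R != 0)).
  by rewrite pnatr_eq0 -lt0n.
rewrite mulfVK; last by rewrite pnatr_eq0 -lt0n.
rewrite [RHS]pair_big /=.
pose h (u : {ffun I -> T} * T) := (update u.1 i u.2, u.1 i).
have hK : involutive h.
  move=> [t x]; rewrite /h /= update_same; congr (_, _); apply/ffunP => j.
  by rewrite !ffunE; case: eqP => [->|].
rewrite (reindex_inj (inv_inj hK)) /=.
transitivity (\sum_(u : {ffun I -> T} * T) (E u.1)%:R : R); last first.
  apply: eq_bigr => -[t x] _ /=; congr (E _)%:R; apply/ffunP => j.
  by rewrite !ffunE; case: eqP => [->|].
rewrite -(pair_big predT predT (fun t x => (E t)%:R)) /= mulr_suml.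
by apply: eq_bigr => t _; rewrite sumr_const mulr_natr.
Qed.

(** A conditional bound, given all coordinates but the [i]-th. *)
Lemma freq_resample_le (E F : pred {ffun I -> T}) i (e : R) :
  (forall t, freq (fun x => E (update t i x)) <= e * (F t)%:R) ->
  freq E <= e * freq F.
Proof.
move=> H; rewrite (freq_resample E i) freqE mulrA ler_wpM2r ?invr_ge0 //.
by rewrite mulr_sumr; apply: ler_sum => t _; exact: H.
Qed.

Lemma freq_product (E : I -> pred T) :
  freq (fun t : {ffun I -> T} => [forall i, E i (t i)]) = \prod_i freq (E i).
Proof.
under [RHS]eq_bigr do rewrite freqE.
rewrite freqE prodf_div prodr_const card_ffun natrX; congr (_ / _).
rewrite bigA_distr_bigA; apply: eq_bigr => t _.
case: forallP => [Et|nEt]; first by rewrite big1 // => i _; rewrite Et.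
have [i nEi] : exists i, ~~ E i (t i).
  by apply/existsP; rewrite -negb_forall; apply/forallP.
by rewrite (bigD1 i) //= (negPf nEi) mul0r.
Qed.

Lemma freq_partition (J : finType) (h : T -> J) (E : pred J) :
  freq (fun t => E (h t)) = \sum_(c | E c) freq (fun t => h t == c).
Proof.
under [RHS]eq_bigr do rewrite freqE.
rewrite freqE -mulr_suml; congr (_ / _).
rewrite exchange_big; apply: eq_bigr => t _; rewrite big_mkcond (bigD1 (h t)) //=.
rewrite eqxx big1 ?addr0; first by case: (E _).
by move=> c; rewrite eq_sym => /negPf ->; rewrite if_same.
Qed.

End Families.
End Frequency.

(** * Concentration of the random walk *)

Lemma prime_dvdn_fact q L : prime q -> (q %| L`!)%N = (q <= L)%N.
Proof.
move=> q_prime; apply/idP/idP => [|qL]; last by rewrite dvdn_fact ?prime_gt0.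
elim: L => [|L IH]; first by rewrite dvdn1 => /eqP q1; rewrite q1 in q_prime.
rewrite factS Euclid_dvdM // => /orP[/dvdn_leq -> //|/IH qL].
exact: leqW.
Qed.

Section Concentration.
Variables (R : realFieldType) (K : fieldExtType rat) (d : nat).
Hypothesis dimK : \dim {:K} = d.
Variable omega : 'I_d -> ringOfIntegers K.
Hypothesis basis_omega : integral_basis omega.
Local Notation O := (ringOfIntegers K).
Local Notation freq := (freq R).

(** [t j] is the set of times at which the step along [omega j] is positive. *)
Definition position M (t : {ffun 'I_d -> {set 'I_M}}) : O :=
  comb omega (fun j => (#|t j|.*2)%:Z - M%:Z).

Lemma position_update M (t : {ffun 'I_d -> {set 'I_M}}) j (A B : {set 'I_M}) :
  position (update t j A) - position (update t j B) =
  omega j * 2%:R * (#|A|%:R - #|B|%:R).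
Proof.
rewrite /position /comb -sumrB (bigD1 j) //= big1 ?addr0 => [|i ij].
  rewrite !update_same -mulrzBr.
  have -> : (#|A|.*2)%:Z - M%:Z - ((#|B|.*2)%:Z - M%:Z) =
    2 * (#|A|%:Z - #|B|%:Z) by rewrite -!muln2 !PoszM; ring.
  by rewrite -mulrzr intrM intrD mulrNz mulrA.
by rewrite !update_other // subrr.
Qed.

(** Freeze all coordinates but the [j]-th one.  Then [D * position t + y] lies in
    [I] only if the [j]-th coordinate falls in one class modulo [Q]. *)
Lemma freq_position_le M r Q (I : set O) j (D y : O) :
  (0 < Q)%N -> (0 < r)%N -> (r ^ 2 <= M)%N -> is_ideal I ->
  (forall k l, (k <= M)%N -> (l <= M)%N ->
     I (D * (omega j * 2%:R * (k%:R - l%:R))) -> k = l %[mod Q]) ->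
  freq (fun t : {ffun 'I_d -> {set 'I_M}} => `[< I (D * position t + y) >])
    <= Q%:R^-1 + 2 / r%:R.
Proof.
move=> Q0 r0 rM idI sep; set e : R := _ + _.
have e0 : 0 <= e by rewrite addr_ge0 ?invr_ge0 ?divr_ge0 ?ler0n.
set E := fun t => _.
apply: (@le_trans _ _ (e * freq (@predT {ffun 'I_d -> {set 'I_M}}))); last first.
  by rewrite ler_piMr // freq_le1.
apply: (@freq_resample_le _ _ _ _ _ j) => t; rewrite mulr1.
have [[A0 EA0]|nE] := pselect (exists A, E (update t j A)); last first.
  apply: le_trans e0; rewrite freqE big1 ?mul0r // => A _.
  by case EA: (E _) => //; exfalso; apply: nE; exists A.
apply: (@le_trans _ _ (freq (fun A : {set 'I_M} => (#|A| %% Q == #|A0| %% Q)%N))).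
  apply: freq_sub => A /asboolP EA; apply/eqP; apply: sep.
  - by rewrite (leq_trans (max_card _)) ?card_ord.
  - by rewrite (leq_trans (max_card _)) ?card_ord.
  rewrite -(position_update t) mulrBr; move/asboolP: EA0 => EA0.
  by have := idealB idI EA EA0; rewrite opprD addrACA subrr addr0.
have := @class_frequency R M Q Q0 r _ r0 rM (ltn_pmod #|A0| Q0).
rewrite /freq card_sets.
have -> : #|(fun A : {set 'I_M} => (#|A| %% Q == #|A0| %% Q)%N)| =
    class_count M Q (#|A0| %% Q)%N.
  by apply: eq_card => A; rewrite inE.
by rewrite ler_distl addrC => /andP[_].
Qed.

Lemma basis_notin_prime (p : set O) : is_prime p -> exists j, ~ p (omega j).
Proof.
move=> [idp p1 _]; apply: contrapT => np; apply: p1.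
rewrite -(cooK basis_omega 1); apply: ideal_sum => // j _.
rewrite -mulrzr; apply: ideal_mulr => //.
by apply: contrapT => npj; apply: np; exists j.
Qed.

Lemma natr_eq_mod_prime (p : set O) q k l : is_prime p -> prime q ->
  p q%:R -> p (k%:R - l%:R) -> k = l %[mod q].
Proof.
move=> prime_p q_prime pq; wlog lk : k l / (l <= k)%N.
  move=> wl pkl; have [lk|/ltnW kl] := leqP l k; first exact: wl.
  by apply/esym/wl => //; apply: idealBC => //; case: prime_p.
rewrite -natrB // => /(natr_in_prime prime_p q_prime pq).
by rewrite -eqn_mod_dvd // => /eqP.
Qed.

(** Some basis vector is outside [p], and its coordinate is spread modulo [q]. *)
Lemma freq_position_prime_le M r L (p : set O) q (y : O) :
  (0 < r)%N -> (r ^ 2 <= M)%N -> (2 <= L)%N -> is_prime p -> prime q ->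
  p q%:R -> (L < q)%N ->
  freq (fun t : {ffun 'I_d -> {set 'I_M}} => `[< p (L`!%:R * position t + y) >])
    <= q%:R^-1 + 2 / r%:R.
Proof.
move=> r0 rM L_ge2 prime_p q_prime pq Lq; have [j npj] := basis_notin_prime prime_p.
have [idp p1 pM] := prime_p.
apply: (@freq_position_le M r q p j) => //; first exact: prime_gt0.
move=> k l _ _ /pM[/(natr_in_prime prime_p q_prime pq)|].
  by rewrite prime_dvdn_fact // leqNgt Lq.
move=> /pM[/pM[//|]|]; last exact: natr_eq_mod_prime.
move=> /(natr_in_prime prime_p q_prime pq)/dvdn_leq => /(_ isT) q2.
by move: q2; rewrite leqNgt (leq_ltn_trans L_ge2 Lq).
Qed.

(** The concentration bound for the zero ideal, where any two values of a coordinate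
    are separated modulo [M.+1]. *)
Lemma freq_position_eq_le M r (D y : O) :
  (0 < r)%N -> (r ^ 2 <= M)%N -> (0 < d)%N -> D != 0 ->
  freq (fun t : {ffun 'I_d -> {set 'I_M}} => D * position t + y == 0)
    <= 3 / r%:R.
Proof.
move=> r0 rM d0 D0; pose j := Ordinal d0.
have rR : (0 : R) < r%:R by rewrite ltr0n.
apply: (@le_trans _ _ (M.+1%:R^-1 + 2 / r%:R)); last first.
  have -> : 3 / r%:R = r%:R^-1 + 2 / r%:R :> R by ring.
  rewrite lerD2r lef_pV2 ?posrE ?ltr0n // ler_nat.
  apply: leq_trans (leqW rM); rewrite -{1}(expn1 r); exact: leq_pexp2l.
have id0 : is_ideal [set z : O | z = 0].
  split=> //= [x z -> ->|b z ->]; by rewrite ?addr0 ?mulr0.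
apply: le_trans (freq_position_le (I := [set z | z = 0]) (j := j) (D := D) y
  (ltn0Sn M) r0 rM id0 _).
  by apply: freq_sub => t /eqP ?; apply/asboolP.
have j0 : omega j != 0.
  apply/eqP => wj; have := combK basis_omega (fun i => (i == j)%:Z) j.
  rewrite /comb (bigD1 j) //= wj mul0rz add0r big1 => [|i /negPf->]; last first.
    by rewrite mulr0z.
  by rewrite -[0](mulr0 (0%:R)) cooM mulr0.
move=> k l _ _ H; congr (_ %% _)%N; move: H.
wlog lk : k l / (l < k)%N => [wl H|].
  have [lk|kl|//] := ltngtP l k; first exact: wl.
  apply/esym/wl => //; rewrite /= -opprB !mulrN; apply/eqP; rewrite oppr_eq0.
  by apply/eqP; exact: H.
move=> /= /eqP; apply: contraTeq => _; rewrite -natrB ?(ltnW lk) //.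
by rewrite !O_mulf_neq0 // O_natr_eq0 // subn_eq0 -ltnNge.
Qed.

End Concentration.

(** * Two coincidences modulo one prime *)

(** A repetition-free list of maximal length is exhaustive. *)
Lemma enumerate_bounded (X : Type) (x0 : X) (P : set X) N :
  (forall g (f : 'I_g -> X), injective f -> (forall i, P (f i)) -> (g <= N)%N) ->
  exists f : 'I_N -> X, forall x, P x -> exists i, f i = x.
Proof.
move=> bound.
pose good g := `[< exists2 f : 'I_g -> X, injective f & forall i, P (f i) >].
have good0 : exists g, good g.
  by exists 0%N; apply/asboolP; exists (fun _ => x0); case.
have good_le g : good g -> (g <= N)%N by move=> /asboolP[f]; exact: bound.
case: (ex_maxnP good0 good_le) => g /asboolP[f f_inj fP] gmax.
have gN : (g <= N)%N by exact: bound f_inj fP.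
exists (fun i : 'I_N => if insub (i : nat) is Some j then f j else x0) => x Px.
have [[j <-]|nfx] := pselect (exists j, f j = x).
  exists (widen_ord gN j) => /=; case: insubP => [j' _ /val_inj -> //|].
  by rewrite ltn_ord.
have : good g.+1; last by move=> /gmax; rewrite ltnn.
apply/asboolP; exists (fun i => oapp f x (unlift ord0 i)).
  move=> i j; case: (unliftP ord0 i) => [i'|] ->; case: (unliftP ord0 j) => [j'|] -> //=.
  - by move=> /f_inj ->.
  - by move=> fx; exfalso; apply: nfx; exists i'.
  - by move=> xf; exfalso; apply: nfx; exists j'.
by move=> i; case: unliftP => [i'|] _ /=.
Qed.

Section CrowdedPrimes.
Variables (R : realFieldType) (K : fieldExtType rat) (d : nat).
Hypothesis dimK : \dim {:K} = d.
Variable omega : 'I_d -> ringOfIntegers K.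
Hypothesis basis_omega : integral_basis omega.
Hypothesis d_ge2 : (2 <= d)%N.
Local Notation O := (ringOfIntegers K).
Local Notation freq := (freq R).
Variable n : nat.
Local Notation m := (n + d)%N.

(** The indices whose class has not occurred before are pairwise distinct modulo
    [I].  So there are at most [n] of them, and at least [d >= 2] others. *)
Lemma crowded_two_repeats (I : set O) (x : 'I_m -> O) :
  is_ideal I -> ~ distinct_mod n.+1 x I ->
  exists i1 j1 i2 j2 : 'I_m, [/\ [&& j1 < i1, i1 < i2 & j2 < i2]%N,
    I (x i1 - x j1) & I (x i2 - x j2)].
Proof.
move=> idI crowded.
pose rep (i : 'I_m) := `[< exists2 j : 'I_m, (j < i)%N & I (x i - x j) >].
have card_rep : (1 < #|[set i | rep i]%SET|)%N.
  rewrite ltnNge; apply/negP => few; apply: crowded.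
  exists (~: [set i | rep i])%SET.
    have := cardsC [set i | rep i]%SET; rewrite card_ord.
    move: few; move: #|[set i | rep i]%SET| #|(~: [set i | rep i])%SET| => u v.
    by clear dimK; move: d_ge2; lia.
  move=> i j; rewrite !inE => ri rj Iij; apply/eqP/negPn/negP => neq.
  have [ij|ji|/val_inj/eqP] := ltngtP i j; last by rewrite (negPf neq).
    by move/negP: rj; apply; apply/asboolP; exists i => //; exact: idealBC.
  by move/negP: ri; apply; apply/asboolP; exists j.
have /card_gt1P[i1 [i2 []]] := card_rep.
rewrite !finset.in_set => ra rb neq.
have {ra rb neq i1 i2} [i1 [i2 [i12 r1 r2]]] :
    exists i1 i2 : 'I_m, [/\ (i1 < i2)%N, rep i1 & rep i2].
  have [i12|i21|/val_inj/eqP] := ltngtP i1 i2; last by rewrite (negPf neq).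
    by exists i1, i2.
  by exists i2, i1.
move/asboolP: r1 => [j1 j1i1 I1]; move/asboolP: r2 => [j2 j2i2 I2].
by exists i1, j1, i2, j2; split => //; apply/and3P.
Qed.

Variables (L : nat) (a : 'I_m -> O).
Hypothesis L_ge2 : (2 <= L)%N.

Section Steps.
Variables (M r : nat).
Hypotheses (r_gt0 : (0 < r)%N) (rM : (r ^ 2 <= M)%N).

Definition sample := {ffun 'I_m -> {ffun 'I_d -> {set 'I_M}}}.

Definition sample_point (t : sample) : 'I_m -> O :=
  shifted L a (fun i => position omega (t i)).

Lemma sample_point_update t i x j :
  sample_point (update t i x) j = if j == i then a i + L`!%:R * position omega x
                           else sample_point t j.
Proof.
rewrite /sample_point /shifted; case: eqP => [->|/eqP ji]; first by rewrite update_same.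
by rewrite update_other.
Qed.

Let below (p : set O) q := [/\ is_prime p, prime q, p q%:R & (L < q)%N].

Lemma freq_meet_le p q (t : sample) (i j : 'I_m) : below p q -> i != j ->
  freq (fun x => `[< p (sample_point (update t i x) i -
                        sample_point (update t i x) j) >])
    <= q%:R^-1 + 2 / r%:R.
Proof.
move=> [prime_p q_prime pq Lq] ij.
rewrite (@eq_freq _ _ _ (fun x => `[< p (L`!%:R * position omega x +
    (a i - sample_point t j)) >])).
  exact: freq_position_prime_le.
move=> x; congr (asbool (p _)); rewrite !sample_point_update eqxx eq_sym (negPf ij).
by rewrite addrAC addrA [LHS]addrC addrA.
Qed.

(** Resampling the walk [i2] does not touch the first coincidence, because [i2]
    exceeds [i1] and [j1]; then the walk [i1] is resampled. *)
Lemma freq_two_repeats_le p q (i1 j1 i2 j2 : 'I_m) : below p q ->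
  [&& j1 < i1, i1 < i2 & j2 < i2]%N ->
  freq (fun t : sample => `[< p (sample_point t i1 - sample_point t j1) >] &&
                          `[< p (sample_point t i2 - sample_point t j2) >])
    <= (q%:R^-1 + 2 / r%:R) ^+ 2.
Proof.
move=> bel /and3P[ji1 i12 ji2]; set e : R := _ + _.
have e0 : 0 <= e by rewrite addr_ge0 ?invr_ge0 ?divr_ge0 ?ler0n.
have neq (i j : 'I_m) : (j < i)%N -> i != j by move=> ji; rewrite neq_ltn ji orbT.
rewrite expr2.
apply: (@le_trans _ _ (e * freq (fun t : sample =>
    `[< p (sample_point t i1 - sample_point t j1) >]))).
  apply: (@freq_resample_le _ _ _ _ _ i2) => t.
  have -> : sample_point t i1 - sample_point t j1 =
      sample_point (update t i2 (t i2)) i1 - sample_point (update t i2 (t i2)) j1.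
    rewrite !sample_point_update ![_ == i2]eq_sym (negPf (neq _ _ i12)).
    by rewrite (negPf (neq _ _ (ltn_trans ji1 i12))).
  have same x : sample_point (update t i2 x) i1 - sample_point (update t i2 x) j1 =
      sample_point t i1 - sample_point t j1.
    rewrite !sample_point_update ![_ == i2]eq_sym (negPf (neq _ _ i12)).
    by rewrite (negPf (neq _ _ (ltn_trans ji1 i12))).
  rewrite same; case: asboolP => [p1|np1].
    rewrite mulr1; apply: le_trans (freq_meet_le t bel (neq _ _ ji2)).
    by apply: freq_sub => x /andP[].
  rewrite mulr0 freqE big1 ?mul0r // => x _.
  by rewrite same (asboolF np1).
apply: ler_wpM2l => //.
apply: (@le_trans _ _ (e * freq (@predT sample))); last by rewrite ler_piMr ?freq_le1.
apply: (@freq_resample_le _ _ _ _ _ i1) => t; rewrite mulr1.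
exact: freq_meet_le bel (neq _ _ ji1).
Qed.

Lemma primes_above_enum q : prime q -> exists f : 'I_d -> set O,
  forall p, is_prime p /\ p q%:R -> exists i, f i = p.
Proof.
move=> q_prime; apply: (@enumerate_bounded _ setT) => g f f_inj fP.
exact: (card_primes_above dimK basis_omega q_prime f_inj).
Qed.

Local Notation crowded_at q :=
  (fun t : sample => crowded L a (fun i => position omega (t i)) q).

Local Notation quads := (('I_m * 'I_m) * ('I_m * 'I_m))%type.

Lemma freq_crowded_at_le q : prime q -> (L < q)%N -> (q <= r)%N ->
  freq (fun t : sample => `[< crowded_at q t >]) <= (d * m ^ 4)%:R * (9 / q%:R ^+ 2).
Proof.
move=> q_prime Lq qr; have [f fP] := primes_above_enum q_prime.
have q0 : (0 : R) < q%:R by rewrite ltr0n prime_gt0.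
have r0 : (0 : R) < r%:R by rewrite ltr0n.
pose F (w : 'I_d * quads) (t : sample) :=
  [&& `[< is_prime (f w.1) /\ f w.1 q%:R >],
      [&& w.2.1.2 < w.2.1.1, w.2.1.1 < w.2.2.1 & w.2.2.2 < w.2.2.1]%N,
      `[< f w.1 (sample_point t w.2.1.1 - sample_point t w.2.1.2) >] &
      `[< f w.1 (sample_point t w.2.2.1 - sample_point t w.2.2.2) >]].
apply: (@le_trans _ _ (\sum_(w : 'I_d * quads) freq (F w))).
  apply: freq_cover => t /asboolP[p pP crowded].
  have [idp _ _] := pP.1; have [i fi] := fP p pP.
  have [i1 [j1 [i2 [j2 [ord p1 p2]]]]] := crowded_two_repeats idp crowded.
  apply/hasP; exists (i, ((i1, j1), (i2, j2))); first by rewrite mem_index_enum.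
  by rewrite /F /= fi ord !asboolT.
have -> : (d * m ^ 4)%:R * (9 / q%:R ^+ 2) =
    \sum_(w : 'I_d * quads) 9 / q%:R ^+ 2 :> R.
  rewrite sumr_const !card_prod !card_ord mulr_natl; congr (_ *+ (_ * _)).
  by rewrite !expnS expn0; ring.
apply: ler_sum => -[i [[i1 j1] [i2 j2]]] _ /=.
have [H|nH] := boolP (`[< is_prime (f i) /\ f i q%:R >] &&
    [&& j1 < i1, i1 < i2 & j2 < i2]%N); last first.
  rewrite freqE big1 ?mul0r ?divr_ge0 ?exprn_ge0 ?ler0n // => t _.
  by rewrite /F /= andbA (negPf nH).
move: H => /andP[/asboolP[prime_p pq] ord].
apply: (@le_trans _ _ ((q%:R^-1 + 2 / r%:R) ^+ 2)).
  apply: le_trans (freq_two_repeats_le (p := f i) (q := q) _ ord) => //.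
  by apply: freq_sub => t /and4P[_ _ -> ->].
have -> : 9 / q%:R ^+ 2 = (3 / q%:R) ^+ 2 :> R by field; rewrite gt_eqF.
rewrite ler_sqr ?nnegrE; first last.
- by rewrite divr_ge0 ?ler0n.
- by rewrite addr_ge0 ?invr_ge0 ?divr_ge0 ?ler0n.
have -> : 3 / q%:R = q%:R^-1 + 2 / q%:R :> R by ring.
rewrite lerD2l ler_wpM2l // lef_pV2 ?posrE //.
by rewrite ler_nat.
Qed.

End Steps.
End CrowdedPrimes.

(** * All large primes at once *)

(** The square of a product of [k] primes above [r] is at least [M ^ k]. *)
Lemma few_large_primes N M r e : (0 < N)%N -> (N <= M ^ e)%N ->
  (M < r.+1 ^ 2)%N -> (2 <= M)%N ->
  (size [seq q <- primes N | r < q] <= e.*2)%N.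
Proof.
move=> N0 NM Mr M2.
have prod_le : (\prod_(q <- [seq q <- primes N | r < q]) q <= N)%N.
  rewrite {2}(prod_prime_decomp N0) prime_decompE big_map big_filter /=.
  rewrite big_mkcond big_seq [leqRHS]big_seq; apply: leq_prod => q qN.
  have q_gt0 : (0 < q)%N by move: qN; rewrite mem_primes => /andP[/prime_gt0].
  have : (0 < logn q N)%N by rewrite logn_gt0.
  case: (logn q N) => // l _; rewrite expnS; case: ifP => _.
    by rewrite leq_pmulr // expn_gt0 q_gt0.
  by rewrite muln_gt0 q_gt0 expn_gt0 q_gt0.
have pow_le s : all (fun q => r < q)%N s ->
    (M ^ size s <= (\prod_(q <- s) q) ^ 2)%N.
  elim: s => [|q s IH] /=; first by rewrite big_nil.
  move=> /andP[rq /IH{}IH]; rewrite big_cons expnS expnMn leq_mul //.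
  by apply: leq_trans (ltnW Mr) _; rewrite leq_sqr.
rewrite -(leq_exp2l _ _ M2); apply: leq_trans (pow_le _ (filter_all _ _)) _.
rewrite -muln2 expnM leq_sqr; exact: leq_trans prod_le NM.
Qed.

Lemma sum_inv_squares_le (R : realFieldType) Y r : (0 < Y)%N ->
  \sum_(Y.+1 <= q < r.+1) (q%:R ^+ 2)^-1 <= Y%:R^-1 :> R.
Proof.
move=> Y0; have YR : (0 : R) < Y%:R by rewrite ltr0n.
have [rY|Yr] := leqP r Y; first by rewrite big_geq ?invr_ge0 ?ltW.
suff H k : \sum_(Y.+1 <= q < (Y + k).+1) (q%:R ^+ 2)^-1 <=
    Y%:R^-1 - (Y + k)%:R^-1 :> R.
  have := H (r - Y)%N; rewrite subnKC ?(ltnW Yr) // => /le_trans; apply.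
  by rewrite gerBl invr_ge0 ler0n.
elim: k => [|k IH]; first by rewrite addn0 big_geq // subrr.
rewrite addnS big_nat_recr /=; last by rewrite ltnS leq_addr.
apply: le_trans (lerD IH (lexx _)) _.
have sR : (0 : R) < (Y + k)%:R by rewrite ltr0n addn_gt0 Y0.
rewrite -natr1; move: ((Y + k)%:R : R) sR => s sR.
have s1 : 0 < s + 1 by rewrite addr_gt0.
rewrite -addrA lerD2l -subr_ge0.
have -> : - (s + 1)^-1 - (- s^-1 + ((s + 1) ^+ 2)^-1) =
    (s * (s + 1) ^+ 2)^-1 :> R.
  by field; rewrite !gt_eqF.
by rewrite invr_ge0 mulr_ge0 ?exprn_ge0 ?ltW.
Qed.

Section FarPrimes.
Variables (R : realFieldType) (K : fieldExtType rat) (d : nat).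
Hypothesis dimK : \dim {:K} = d.
Variable omega : 'I_d -> ringOfIntegers K.
Hypothesis basis_omega : integral_basis omega.
Hypothesis d_ge2 : (2 <= d)%N.
Local Notation O := (ringOfIntegers K).
Local Notation freq := (freq R).
Variable n : nat.
Local Notation m := (n + d)%N.
Variables (L : nat) (a : 'I_m -> O).
Hypothesis L_ge2 : (2 <= L)%N.

Local Notation sample := (sample d n).
Local Notation point := (sample_point omega L a).
Local Notation quads := (('I_m * 'I_m) * ('I_m * 'I_m))%type.

Let d_gt0 : (0 < d)%N. Proof. exact: ltnW. Qed.

(** The coordinates of the random points are at most [spread * M]. *)
Definition spread : nat := (\sum_i \sum_k `|coo basis_omega (a i) k| + L`!)%N.

Lemma coo_point_le M (t : sample M) i k : (0 < M)%N ->
  (`|coo basis_omega (point t i) k| <= spread * M)%N.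
Proof.
move=> M0; rewrite -lez_nat abszE cooD cooM combK.
apply: le_trans (ler_normD _ _) _.
have -> : (spread * M)%N%:Z = ((\sum_i \sum_k `|coo basis_omega (a i) k|) * M)%N%:Z
    + M%:Z * L`!%:Z.
  by rewrite /spread mulnDl PoszD [X in _ + X]PoszM mulrC.
apply: lerD.
  rewrite -abszE lez_nat; apply: leq_trans (leq_pmulr _ M0).
  by rewrite (bigD1 i) //= (bigD1 k) //= -addnA leq_addr.
rewrite normrM ler_pM //.
have : (#|t i k| <= M)%N by rewrite -[X in (_ <= X)%N]card_ord max_card.
move: #|t i k| => c cM; rewrite ler_norml; lia.
Qed.

(** A nonzero difference of two points divides a nonzero integer of size
    [O(M ^ d)].  If [r] is the integer part of the square root of [M], this
    integer has boundedly many prime divisors above [r], each of which lies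
    below at most [d] primes. *)
Lemma enumerate_divisors : exists C0 : nat, forall M r, (C0 <= M)%N ->
  (M < r.+1 ^ 2)%N -> forall (t : sample M) i j, point t i != point t j ->
  exists f : 'I_d.+1.*2 * 'I_d -> set O * nat, forall p q,
    [/\ is_prime p, prime q, p q%:R & (r < q)%N] ->
    p (point t i - point t j) -> exists w, f w = (p, q).
Proof.
have [C HC] := small_multiple dimK basis_omega.
exists (maxn 2 (C * (2 * spread) ^ d)) => M r.
rewrite geq_max => /andP[M2 MC] Mr t i j neq.
have M0 : (0 < M)%N by exact: ltnW.
have [|k|N [y [N0 NH zN]]] := HC (point t i - point t j) (2 * spread * M)%N.
- by rewrite subr_eq0.
- rewrite cooD cooN; have := coo_point_le t i k M0; have := coo_point_le t j k M0.
  move: (coo _ _ k) (coo _ _ k) => u v; rewrite -mulnA; lia.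
have NM : (N <= M ^ d.+1)%N.
  by apply: leq_trans NH _; rewrite expnMn mulnA expnS leq_mul2r MC orbT.
have few := few_large_primes N0 NM Mr M2.
set s := [seq q <- primes N | _] in few.
have /choice[f Hf] : forall q, exists f : 'I_d -> set O,
    prime q -> forall p, is_prime p /\ p q%:R -> exists i, f i = p.
  move=> q; have [q_prime|nq] := boolP (prime q); last by exists (fun _ => setT).
  by have [f Hf] := primes_above_enum dimK basis_omega q_prime; exists f.
exists (fun w : 'I_d.+1.*2 * 'I_d => (f (nth 0%N s w.1) w.2, nth 0%N s w.1)).
move=> p q [prime_p q_prime pq rq] pz.
have qs : q \in s.
  rewrite mem_filter rq mem_primes q_prime N0 /=.
  apply/(natr_in_prime prime_p q_prime pq); rewrite -zN.
  by apply: ideal_mulr => //; case: prime_p.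
have lt_idx : (index q s < d.+1.*2)%N by apply: leq_trans few; rewrite index_mem.
have [l fl] := Hf q q_prime p (conj prime_p pq).
by exists (Ordinal lt_idx, l); rewrite /= nth_index // fl.
Qed.

Section Far.
Variables (M r : nat).
Hypotheses (r_gt0 : (0 < r)%N) (rM : (r ^ 2 <= M)%N).

Lemma freq_coincide_le (i j : 'I_m) : i != j ->
  freq (fun t : sample M => point t i == point t j) <= 3 / r%:R.
Proof.
move=> ij; set e : R := _ / _.
have e0 : 0 <= e by rewrite divr_ge0 ?ler0n.
apply: (@le_trans _ _ (e * freq (@predT (sample M)))); last by rewrite ler_piMr ?freq_le1.
apply: (@freq_resample_le _ _ _ _ _ i) => t; rewrite mulr1.
apply: le_trans (freq_position_eq_le R basis_omega (D := L`!%:R)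
  (a i - point t j) r_gt0 rM d_gt0 _); last by rewrite O_natr_eq0 -lt0n fact_gt0.
apply: freq_sub => x.
rewrite -subr_eq0 !sample_point_update eqxx [j == i]eq_sym (negPf ij).
by rewrite addrAC addrC.
Qed.

(** Primes above [r] are treated together, since the sum over them of the bounds
    for a single prime would diverge. *)
Definition far (t : sample M) (u : quads) :=
  exists p q, [/\ is_prime p, prime q, p q%:R & (maxn r L < q)%N] /\
    (p (point t u.1.1 - point t u.1.2) /\ p (point t u.2.1 - point t u.2.2)).

Hypothesis Henum : forall (t : sample M) i j, point t i != point t j ->
  exists f : 'I_d.+1.*2 * 'I_d -> set O * nat, forall p q,
    [/\ is_prime p, prime q, p q%:R & (r < q)%N] ->
    p (point t i - point t j) -> exists w, f w = (p, q).

(** The first coincidence is a property of the walks other than [i2]; given these,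
    if [point t i1] and [point t j1] differ then boundedly many primes can produce
    it, and at each of them the walk [i2] produces the second coincidence with
    probability at most [3 / r]. *)
Lemma freq_far_le (i1 j1 i2 j2 : 'I_m) :
  [&& j1 < i1, i1 < i2 & j2 < i2]%N ->
  freq (fun t : sample M => (point t i1 != point t j1) &&
          `[< far t ((i1, j1), (i2, j2)) >])
    <= (d.+1.*2 * d)%:R * (3 / r%:R).
Proof.
move=> /and3P[ji1 i12 ji2]; set e : R := _ * _.
have e0 : 0 <= e by rewrite mulr_ge0 ?divr_ge0 ?ler0n.
have r0 : (0 : R) < r%:R by rewrite ltr0n.
apply: (@le_trans _ _ (e * freq (@predT (sample M)))); last by rewrite ler_piMr ?freq_le1.
apply: (@freq_resample_le _ _ _ _ _ i2) => t; rewrite mulr1.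
have i1' : i1 != i2 by rewrite neq_ltn i12.
have j1' : j1 != i2 by rewrite neq_ltn (ltn_trans ji1 i12).
have ij2 : i2 != j2 by rewrite neq_ltn ji2 orbT.
have [zt|zt] := boolP (point t i1 == point t j1).
  rewrite freqE big1 ?mul0r // => x _.
  by rewrite !sample_point_update (negPf i1') (negPf j1') zt.
have [f Hf] := Henum zt.
pose F (w : 'I_d.+1.*2 * 'I_d) x := [&&
  `[< [/\ is_prime (f w).1, prime (f w).2, (f w).1 (f w).2%:R & (maxn r L < (f w).2)%N] >] &
  `[< (f w).1 (point (update t i2 x) i2 - point (update t i2 x) j2) >]].
apply: (@le_trans _ _ (\sum_(w : 'I_d.+1.*2 * 'I_d) freq (F w))).
  apply: freq_cover => x /andP[_ /asboolP[p [q [pqP []]]]] /=.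
  rewrite ![sample_point _ _ _ _ i1]sample_point_update.
  rewrite ![sample_point _ _ _ _ j1]sample_point_update.
  rewrite (negPf i1') (negPf j1') => pz p2.
  have [prime_p q_prime pq] := pqP; rewrite gtn_max => /andP[rq Lq].
  have [//|w fw] := Hf p q _ pz.
  apply/hasP; exists w; first by rewrite mem_index_enum.
  by rewrite /F fw /= !asboolT.
have -> : e = \sum_(w : 'I_d.+1.*2 * 'I_d) 3 / r%:R.
  by rewrite /e sumr_const card_prod !card_ord -[RHS]mulr_natl.
apply: ler_sum => w _.
have [/asboolP[prime_p q_prime pq rLq]|nH] := boolP `[< [/\ is_prime (f w).1,
    prime (f w).2, (f w).1 (f w).2%:R & (maxn r L < (f w).2)%N] >]; last first.
  rewrite freqE big1 ?mul0r ?divr_ge0 ?ler0n // => x _.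
  by rewrite /F (negPf nH).
move: rLq; rewrite gtn_max => /andP[rq Lq].
apply: (@le_trans _ _ ((f w).2%:R^-1 + 2 / r%:R)).
  apply: le_trans (freq_meet_le R basis_omega a L_ge2 r_gt0 rM
    (p := (f w).1) (q := (f w).2) t _ ij2) => //.
  by apply: freq_sub => x /andP[].
have -> : 3 / r%:R = r%:R^-1 + 2 / r%:R :> R by ring.
have q0 : (0 : R) < (f w).2%:R by rewrite ltr0n prime_gt0.
by rewrite lerD2r lef_pV2 ?posrE // ler_nat ltnW.
Qed.

Local Notation crowded_at q :=
  (fun t : sample M => crowded L a (fun i => position omega (t i)) q).
Local Notation crowded_beyond Y :=
  (fun t : sample M => crowded_above L a (fun i => position omega (t i)) Y).

Lemma freq_crowded_far_le :
  freq (fun t : sample M => `[< crowded_beyond (maxn r L) t >]) <=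
    (m ^ 4)%:R * ((d.+1.*2 * d).+1%:R * (3 / r%:R)).
Proof.
pose ord (u : quads) := [&& u.1.2 < u.1.1, u.1.1 < u.2.1 & u.2.2 < u.2.1]%N.
pose F (u : quads) (t : sample M) := ord u &&
  ((point t u.1.1 == point t u.1.2) ||
   ((point t u.1.1 != point t u.1.2) && `[< far t u >])).
apply: (@le_trans _ _ (\sum_(u : quads) freq (F u))).
  apply: freq_cover => t /asboolP[q [q_prime rLq] [p [prime_p pq] crowded]].
  have [idp _ _] := prime_p.
  have [i1 [j1 [i2 [j2 [ordu p1 p2]]]]] := crowded_two_repeats d_ge2 idp crowded.
  apply/hasP; exists ((i1, j1), (i2, j2)); first by rewrite mem_index_enum.
  rewrite /F /ord ordu /=; case: eqP => //= _.
  by apply/asboolP; exists p, q.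
have -> : (m ^ 4)%:R * ((d.+1.*2 * d).+1%:R * (3 / r%:R)) =
    \sum_(u : quads) (3 / r%:R + (d.+1.*2 * d)%:R * (3 / r%:R)) :> R.
  rewrite sumr_const !card_prod !card_ord -[RHS]mulr_natl.
  congr (_%:R * _); first by rewrite !expnS expn0; ring.
  by rewrite -natr1; ring.
apply: ler_sum => -[[i1 j1] [i2 j2]] _.
have [ordu|nord] := boolP (ord ((i1, j1), (i2, j2))); last first.
  rewrite freqE big1 ?mul0r ?addr_ge0 ?mulr_ge0 ?divr_ge0 ?ler0n // => t _.
  by rewrite /F (negPf nord).
apply: le_trans (lerD (freq_coincide_le (i := i1) (j := j1) _)
                      (freq_far_le ordu)); last first.
  by have /and3P[/= ji _ _] := ordu; rewrite neq_ltn ji orbT.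
apply: le_trans (freqU _ _ _).
by apply: freq_sub => t /andP[].
Qed.

(** Up to [r] the bounds for the single primes have a convergent sum.  Above [r] the
    number of relevant primes is bounded. *)
Lemma freq_crowded_beyond_le Y : (L <= Y)%N ->
  freq (fun t : sample M => `[< crowded_beyond Y t >]) <=
    (d * m ^ 4 * 9)%:R / Y%:R + (m ^ 4 * (d.+1.*2 * d).+1 * 3)%:R / r%:R.
Proof.
move=> LY; have Y0 : (0 < Y)%N by apply: leq_trans LY; exact: ltnW.
apply: (@le_trans _ _ (freq (fun t : sample M =>
    has (fun q => prime q && `[< crowded_at q t >]) (index_iota Y.+1 r.+1) ||
    `[< crowded_beyond (maxn r L) t >]))).
  apply: freq_sub => t /asboolP[q [q_prime Yq] crowded].
  have [qr|rq] := leqP q r.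
    apply/orP; left; apply/hasP; exists q; last by rewrite q_prime asboolT.
    by rewrite mem_index_iota Yq ltnS.
  apply/orP; right; apply/asboolP; exists q => //; split => //.
  by rewrite gtn_max rq (leq_ltn_trans LY).
apply: le_trans (freqU _ _ _) _; apply: lerD; last first.
  apply: le_trans freq_crowded_far_le _.
  by rewrite !mulrA -!natrM.
apply: (@le_trans _ _ (\sum_(Y.+1 <= q < r.+1)
    (d * m ^ 4)%:R * (9 / q%:R ^+ 2))); last first.
  have -> : (d * m ^ 4 * 9)%:R / Y%:R = (d * m ^ 4)%:R * (9 / Y%:R) :> R.
    by rewrite [(_ * 9)%:R]natrM mulrA.
  rewrite -mulr_sumr; apply: ler_wpM2l; first exact: ler0n.
  rewrite -mulr_sumr; apply: ler_wpM2l; first exact: ler0n.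
  exact: sum_inv_squares_le.
apply: (@le_trans _ _ (\sum_(q <- index_iota Y.+1 r.+1)
    freq (fun t : sample M => prime q && `[< crowded_at q t >]))).
  exact: freq_cover.
rewrite big_nat [leRHS]big_nat; apply: ler_sum => q /andP[Yq qr].
have [q_prime|nq] := boolP (prime q); last first.
  by rewrite freqE big1 ?mul0r ?mulr_ge0 ?divr_ge0 ?exprn_ge0 ?ler0n.
apply: le_trans (freq_crowded_at_le R dimK basis_omega d_ge2 a L_ge2 r_gt0 rM
  q_prime _ qr).
  exact: freq_sub.
exact: leq_ltn_trans LY Yq.
Qed.

End Far.
End FarPrimes.

(** * The law of the random walk *)

Section WalkLaw.
Variables (R : realType) (K : fieldExtType rat).
Local Notation O := (ringOfIntegers K).
Local Notation measureOK := {measure set O -> \bar R}.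

Definition has_law (T : finType) (f : T -> O) (mu : measureOK) :=
  forall B : set O, mu B = (freq R (fun t => `[< B (f t) >]))%:E.

Lemma has_law_bij (T T' : finType) (f : T -> O) (mu : measureOK) (h : T' -> T) :
  bijective h -> has_law f mu -> has_law (f \o h) mu.
Proof. by move=> bh lf B; rewrite lf (freq_bij R _ bh). Qed.

Lemma has_law_convolve (T1 T2 : finType) (f1 : T1 -> O) (f2 : T2 -> O)
    (m1 m2 : measureOK) :
  has_law f1 m1 -> has_law f2 m2 ->
  has_law (fun t : T1 * T2 => f1 t.1 + f2 t.2) (convolve m1 m2).
Proof.
move=> l1 l2 B; rewrite /convolve /= /convolution.
pose A (t : T2) : set O := [set x | B (x + f2 t)].
pose c : R := #|T2|%:R^-1.
have c0 : 0 <= c by rewrite invr_ge0.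
transitivity (\int[m1]_(x in setT)
    (\sum_(t <- index_enum T2) (c%:E * (\1_(A t) x)%:E)))%E.
  apply: eq_integral => x _; rewrite l2 freqE -/c.
  under [RHS]eq_bigr do rewrite -EFinM.
  by rewrite sumEFin mulrC mulr_sumr; congr (_%:E).
rewrite ge0_integral_sum //; last first.
  by move=> t x _; rewrite mule_ge0 // lee_fin.
transitivity (\sum_(t <- index_enum T2)
    (c * freq R (fun s => `[< B (f1 s + f2 t) >]))%:E)%E.
  apply: eq_bigr => t _; rewrite ge0_integralZl_EFin // integral_indic //.
  by rewrite setIT l1.
rewrite sumEFin; congr (_%:E); rewrite -mulr_sumr mulrC.
under eq_bigr do rewrite freqE.
rewrite freqE -mulr_suml -mulrA -invfM -natrM mulnC -card_prod; congr (_ / _).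
- by rewrite exchange_big pair_big.
- by rewrite !card_prod mulnC.
Qed.

Lemma has_law_unit (T : finType) (f : T -> O) :
  #|T| = 1%N -> (forall t, f t = 0) -> has_law f (unit_mass R K).
Proof.
move=> T1 f0 B; rewrite /unit_mass /= diracE freqE T1 divr1; congr (_%:E).
under eq_bigr do rewrite f0.
by rewrite sumr_const T1; congr (nat_of_bool _)%:R.
Qed.

Lemma has_law_sign_step (w : O) :
  has_law (fun b : bool => if b then w else - w) (sign_step R w).
Proof.
move=> B.
transitivity (mule (2^-1 : R)%:E (measure_add (dirac w) (dirac (- w)) B)) => //.
rewrite measure_addE /= !diracE freqE card_bool -EFinD -EFinM mulrC; congr (_ / _)%:E.
by rewrite big_bool.
Qed.

Definition ffun_uncons (e : nat) (X : Type) (u : {ffun 'I_e.+1 -> X}) :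
    X * {ffun 'I_e -> X} := (u ord0, [ffun i => u (lift ord0 i)]).

Lemma ffun_uncons_bij e (X : Type) : bijective (@ffun_uncons e X).
Proof.
exists (fun v : X * {ffun 'I_e -> X} =>
  [ffun i : 'I_e.+1 => if unlift ord0 i is Some j then v.2 j else v.1]).
  move=> u; apply/ffunP => i; rewrite ffunE /=.
  by case: unliftP => [j|] -> //=; rewrite ffunE.
move=> [x v]; rewrite /ffun_uncons; congr (_, _).
  by rewrite ffunE unlift_none.
by apply/ffunP => i; rewrite !ffunE liftK.
Qed.

Lemma has_law_step e (w : 'I_e -> O) :
  has_law (fun t : {ffun 'I_e -> bool} => \sum_i (if t i then w i else - w i))
    (step_law R w).
Proof.
rewrite /step_law; elim: e w => [|e IH] w.
  rewrite big_ord0; apply: has_law_unit; first by rewrite card_ffun card_ord.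
  by move=> t; rewrite big_ord0.
rewrite big_ord_recl.
have := has_law_bij (ffun_uncons_bij _ _)
  (has_law_convolve (has_law_sign_step (w ord0)) (IH (fun i => w (lift ord0 i)))).
move=> H B; rewrite H; congr (_%:E); apply: eq_freq => t /=.
congr (asbool (B _)); rewrite big_ord_recl; congr (_ + _).
by apply: eq_bigr => i _; rewrite ffunE.
Qed.

Lemma has_law_walk_steps d (omega : 'I_d -> O) M :
  has_law (fun t : {ffun 'I_M -> {ffun 'I_d -> bool}} =>
      \sum_k \sum_i (if t k i then omega i else - omega i))
    (walk_law R omega M).
Proof.
elim: M => [|M IH].
  apply: has_law_unit; first by rewrite card_ffun card_ord.
  by move=> t; rewrite big_ord0.
have := has_law_bij (ffun_uncons_bij _ _)
  (has_law_convolve (has_law_step omega) IH).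
move=> H B; rewrite [LHS]H; congr (_%:E); apply: eq_freq => t /=.
congr (asbool (B _)); rewrite big_ord_recl; congr (_ + _).
by apply: eq_bigr => k _; apply: eq_bigr => i _; rewrite ffunE.
Qed.

(** The coordinates of the walk are independent: the [i]-th one is determined
    by the set of times at which the step along [omega i] is positive. *)
Lemma has_law_walk d (omega : 'I_d -> O) M :
  has_law (@position K d omega M) (walk_law R omega M).
Proof.
pose h (A : {ffun 'I_d -> {set 'I_M}}) : {ffun 'I_M -> {ffun 'I_d -> bool}} :=
  [ffun k => [ffun i => k \in A i]].
have bh : bijective h.
  exists (fun t : {ffun 'I_M -> {ffun 'I_d -> bool}} => [ffun i => [set k | t k i]%SET]).
    by move=> A; apply/ffunP => i; apply/setP => k; rewrite ffunE inE !ffunE.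
  by move=> t; apply/ffunP => k; apply/ffunP => i; rewrite !ffunE inE.
have := has_law_bij bh (has_law_walk_steps omega M).
move=> H B; rewrite H; congr (_%:E); apply: eq_freq => A /=.
congr (asbool (B _)); rewrite exchange_big; apply: eq_bigr => i _.
under eq_bigr do rewrite !ffunE.
rewrite (bigID (mem (A i))) /=.
under eq_bigr => k kA do rewrite kA.
under [X in _ + X]eq_bigr => k kA do rewrite (negPf kA).
rewrite !sumr_const.
have -> : #|(fun k => k \notin A i)| = (M - #|A i|)%N.
  by rewrite -[X in (X - _)%N](card_ord M) -(cardC (mem (A i))) addKn; exact: eq_card.
have cM : (#|A i| <= M)%N by rewrite -[X in (_ <= X)%N]card_ord max_card.
rewrite mulNrn !pmulrn -mulrzBr; congr (_ *~ _).
by rewrite -subzn // -muln2 PoszM; ring.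
Qed.

End WalkLaw.

(** * The joint law of independent walks *)

Section JointLaw.
Variables (R : realType) (K : fieldExtType rat) (d : nat).
Variable omega : 'I_d -> ringOfIntegers K.
Hypothesis basis_omega : integral_basis omega.
Local Notation O := (ringOfIntegers K).
Variables (disp : measure_display) (Om : measurableType disp).
Variables (P : probability Om R) (m M : nat) (X : 'I_m -> {RV P >-> O}).
Hypothesis indep : mutually_independent X.
Hypothesis law : forall (i : 'I_m) (B : set O),
  distribution P (X i) B = walk_law R omega M B.

Local Notation sample := {ffun 'I_m -> {ffun 'I_d -> {set 'I_M}}}.

Let cell (v : 'I_m -> O) : set Om :=
  \bigcap_(i in [set: 'I_m]) X i @^-1` [set v i].

Let measurable_cell v : measurable (cell v).
Proof.
apply: fin_bigcap_measurable; first exact: finite_finset.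
by move=> i _; rewrite -[_ @^-1` _]setTI; exact: measurable_funP.
Qed.

Let prob_cell v :
  P (cell v) = (\prod_i freq R (fun t => position omega (M := M) t == v i))%:E.
Proof.
rewrite /cell indep // -prodEFin; apply: eq_bigr => i _.
rewrite -[LHS]/(distribution P (X i) [set v i]) law has_law_walk.
by congr (_%:E); apply: eq_freq => t; apply/asboolP/eqP.
Qed.

Let event (V : set ('I_m -> O)) : set Om := [set w | V (fun i => X i w)].

Let measurable_event V : measurable (event V).
Proof.
pose F (c : {ffun 'I_m -> {ffun 'I_d -> int}}) :=
  if `[< V (fun i => comb omega (c i)) >] then cell (fun i => comb omega (c i))
  else set0.
have -> : event V = \bigcup_c F c.
  apply/seteqP; split => w.
    move=> Vw; exists [ffun i => coo basis_omega (X i w)] => //; rewrite /F.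
    have E : (fun i => comb omega ([ffun i => coo basis_omega (X i w)] i)) =
        (fun i => X i w).
      by apply/funext => i; rewrite ffunE cooK.
    by rewrite E asboolT // => i _.
  move=> [c _]; rewrite /F; case: asboolP => // Vc cw.
  rewrite /event /= (_ : (fun i => X i w) = (fun i => comb omega (c i))) //.
  by apply/funext => i; exact: cw.
apply: countable_bigcupT_measurable; first exact: countableP.
by move=> c; rewrite /F; case: asboolP.
Qed.

Let counts := {ffun 'I_m -> {ffun 'I_d -> 'I_M.+1}}.

Let value (k : counts) (i : 'I_m) : O :=
  comb omega (fun j => ((k i j : nat).*2)%:Z - M%:Z).

Let value_inj : injective value.
Proof.
move=> k l kl; apply/ffunP => i; apply/ffunP => j; apply: val_inj.
have := congr1 (fun f => coo basis_omega (f i) j) kl.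
rewrite /value /= !combK; move: (nat_of_ord (k i j)) (nat_of_ord (l i j)) => u v; lia.
Qed.

Let count_set (A : {set 'I_M}) : 'I_M.+1 := inord #|A|.

Let count_setE A : count_set A = #|A| :> nat.
Proof.
by rewrite inordK // ltnS -[X in (_ <= X)%N]card_ord max_card.
Qed.

Let count_sample (t : sample) : counts := [ffun i => [ffun j => count_set (t i j)]].

Let valueE (t : sample) : value (count_sample t) = (fun i => position omega (t i)).
Proof.
apply/funext => i; rewrite /value /position; congr (comb omega _).
by apply/funext => j; rewrite !ffunE count_setE.
Qed.

Let freq_value (k : counts) :
  freq R (fun t : sample => count_sample t == k) =
  \prod_i freq R (fun t => position omega (M := M) t == value k i).
Proof.
rewrite -freq_product; apply: eq_freq => t; apply/eqP/forallP => [<- i|H].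
  by apply/eqP; rewrite valueE.
apply: value_inj; rewrite valueE; apply/funext => i; exact/eqP/H.
Qed.

Let prob_event_ge V :
  ((freq R (fun t : sample => `[< V (fun i => position omega (t i)) >]))%:E
    <= P (event V))%E.
Proof.
pose A := [pred k : counts | `[< V (value k) >]].
pose F (i : 'I_#|A|) := cell (value (enum_val i)).
have mU : measurable (\big[setU/set0]_(i < #|A|) F i).
  by apply: bigsetU_measurable => i _; exact: measurable_cell.
apply: (@le_trans _ _ (P (\big[setU/set0]_(i < #|A|) F i))); last first.
  apply: le_measure; rewrite ?inE //.
  apply: (big_ind (fun B => B `<=` event V)) => //; first by move=> B C HB HC w [/HB|/HC].
  move=> i _ w Fw; have := enum_valP i; rewrite unfold_in /=.
  have -> : value (enum_val i) = (fun j => X j w) by apply/funext => j; rewrite -Fw.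
  by move=> /asboolP.
rewrite measure_semi_additive_ord //; first last.
- move=> i j _ _ [w [Fi Fj]]; apply: enum_val_inj; apply: value_inj.
  apply/funext => k.
  by rewrite -(Fi k) // -(Fj k).
- by move=> i; exact: measurable_cell.
rewrite (eq_bigr (fun i =>
  (freq R (fun t : sample => count_sample t == enum_val i))%:E)); last first.
  by move=> i _; rewrite freq_value; exact: prob_cell.
rewrite sumEFin lee_fin.
rewrite -(big_enum_val (A := A) (fun k => freq R (fun t : sample => count_sample t == k))).
rewrite -freq_partition le_eqVlt; apply/orP; left; apply/eqP.
apply: eq_freq => t.
by rewrite -[RHS]/(`[< V (value (count_sample t)) >]) valueE.
Qed.

(** Events that concern the whole family of walks can be computed by counting.
    The inequality just proved, for an event and for its complement, forces
    equality since both laws have total mass one. *)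
Lemma joint_law (V : set ('I_m -> O)) :
  P (event V) =
  (freq R (fun t : sample => `[< V (fun i => position omega (t i)) >]))%:E.
Proof.
have le1 := prob_event_ge V; have le2 := prob_event_ge (~` V).
have EC : event (~` V) = ~` event V by [].
rewrite EC probability_setC // in le2.
have Pfin : P (event V) \is a fin_num by exact: fin_num_measure.
apply/eqP; rewrite eq_le le1 andbT.
have sum1 : freq R (fun t : sample => `[< V (fun i => position omega (t i)) >]) +
    freq R (fun t : sample => `[< (~` V) (fun i => position omega (t i)) >]) = 1.
  rewrite !freqE -mulrDl -big_split /=.
  rewrite (eq_bigr (fun _ => 1)) => [|t _]; last first.
    case: asboolP => Vt; first by rewrite asboolF ?addr0.
    by rewrite asboolT ?add0r.
  rewrite sumr_const divff // pnatr_eq0 -lt0n.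
  by rewrite !card_ffun card_sets !expn_gt0.
move: le2; rewrite -(fineK Pfin) -EFinB !lee_fin; lra.
Qed.

End JointLaw.

(** * Limits and equidistribution *)

Section Limits.
Variable R : realType.

Lemma cvg_sum_seq (I : Type) (r : seq I) (P : pred I) (f : I -> nat -> R)
    (l : I -> R) :
  (forall i, f i @ \oo --> l i) ->
  (fun M => \sum_(i <- r | P i) f i M) @ \oo --> \sum_(i <- r | P i) l i.
Proof.
move=> fl; elim: r => [|i r IH].
  rewrite big_nil (_ : (fun _ => _) = cst 0); first exact: cvg_cst.
  by apply/funext => M; rewrite big_nil.
rewrite big_cons; case Pi : (P i).
  rewrite (_ : (fun _ => _) = (fun M => f i M + \sum_(j <- r | P j) f j M)).
    exact: cvgD.
  by apply/funext => M; rewrite big_cons Pi.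
rewrite (_ : (fun _ => _) = (fun M => \sum_(j <- r | P j) f j M)) //.
by apply/funext => M; rewrite big_cons Pi.
Qed.

Lemma cvg_prod_seq (I : Type) (r : seq I) (P : pred I) (f : I -> nat -> R)
    (l : I -> R) :
  (forall i, f i @ \oo --> l i) ->
  (fun M => \prod_(i <- r | P i) f i M) @ \oo --> \prod_(i <- r | P i) l i.
Proof.
move=> fl; elim: r => [|i r IH].
  rewrite big_nil (_ : (fun _ => _) = cst 1); first exact: cvg_cst.
  by apply/funext => M; rewrite big_nil.
rewrite big_cons; case Pi : (P i).
  rewrite (_ : (fun _ => _) = (fun M => f i M * \prod_(j <- r | P j) f j M)).
    exact: cvgM.
  by apply/funext => M; rewrite big_cons Pi.
rewrite (_ : (fun _ => _) = (fun M => \prod_(j <- r | P j) f j M)) //.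
by apply/funext => M; rewrite big_cons Pi.
Qed.

(** The values of [u] cluster around the limit of each approximation [v], so [u] is
    a Cauchy sequence. *)
Lemma cvg_of_approximations (u : nat -> R) :
  (forall e : R, 0 < e -> exists2 v : nat -> R, cvgn v &
     \forall M \near \oo, `|u M - v M| <= e) -> cvgn u.
Proof.
move=> approx; apply/cauchy_cvgP/cauchy_exP => e e0.
have e2 : 0 < e / 2 by rewrite divr_gt0.
have [v cv uv] := approx _ e2.
have /cvgrPdist_lt/(_ _ e2) lv : v @ \oo --> limn v by exact: cv.
exists (limn v); change (\forall M \near \oo, ball (limn v) e (u M)).
near=> M; rewrite /ball /=.
have uvM : `|u M - v M| <= e / 2 by near: M.
have lvM : `|limn v - v M| < e / 2 by near: M.
rewrite -(subrKA (v M)) (splitr e); apply: le_lt_trans (ler_normD _ _) _.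
by rewrite (distrC (v M)) ltr_leD.
Unshelve. all: by end_near. Qed.

Lemma isqrt_exists M : exists r, (r ^ 2 <= M)%N /\ (M < r.+1 ^ 2)%N.
Proof.
have ex0 : exists r, (r ^ 2 <= M)%N by exists 0%N.
have bnd r : (r ^ 2 <= M)%N -> (r <= M)%N.
  move=> rM; case: r rM => // r; apply: leq_trans.
  by rewrite -{1}(expn1 r.+1) leq_pexp2l.
case: (ex_maxnP ex0 bnd) => r rM rmax; exists r; split => //.
by rewrite ltnNge; apply/negP => /rmax; rewrite ltnn.
Qed.

End Limits.

Section Equidistribution.
Variables (R : realType) (K : fieldExtType rat) (d : nat).
Variable omega : 'I_d -> ringOfIntegers K.
Hypothesis basis_omega : integral_basis omega.
Local Notation O := (ringOfIntegers K).
Variables (Q m : nat).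
Hypothesis (Q_odd : odd Q).

Let Q_gt0 : (0 < Q)%N. Proof. by case: Q Q_odd. Qed.

Local Notation sample M := {ffun 'I_m -> {ffun 'I_d -> {set 'I_M}}}.

(** The residue of [2 * #|A| - M]: adding [M * Q.-1] amounts to subtracting [M]. *)
Definition coordinate_class M (A : {set 'I_M}) : 'I_Q :=
  Ordinal (ltn_pmod (#|A|.*2 + M * Q.-1) Q_gt0).

Lemma coordinate_class_cvg (c : 'I_Q) :
  (fun M => freq R (fun A : {set 'I_M} => coordinate_class A == c)) @ \oo
    --> (Q%:R^-1 : R).
Proof.
pose b M := ((c + M) * uphalf Q %% Q)%N.
have half2 : (2 * uphalf Q = Q.+1)%N.
  by rewrite uphalf_half; have := odd_double_half Q; rewrite Q_odd; lia.
have freq_class M : freq R (fun A : {set 'I_M} => coordinate_class A == c) =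
    (class_count M Q (b M))%:R / (2 ^ M)%:R.
  rewrite /freq card_sets; congr (_%:R / _); apply: eq_card => A.
  rewrite !inE -topredE /= -val_eqE /= /b.
  rewrite -[X in (_ == X)%N](modn_small (ltn_ord c)).
  have MQ : (M * Q.-1 + M = M * Q)%N by rewrite addnC -mulnS prednK.
  apply/idP/idP => /eqP H; apply/eqP.
    have {}H : (#|A| * 2 = c + M %[mod Q])%N.
      by rewrite -modnDml -H modnDml -addnA MQ addnC modnMDl muln2.
    by rewrite -modnMml -H modnMml -mulnA half2 mulnS addnC modnMDl.
  have : (#|A| * 2 = c + M %[mod Q])%N.
    rewrite -modnMml H modnMml -mulnA [(uphalf Q * 2)%N]mulnC half2 mulnS.
    by rewrite addnC modnMDl.
  move=> AE; apply/eqP; rewrite -muln2 -(eqn_modDr M) -addnA MQ addnC modnMDl.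
  exact/eqP.
apply/cvgrPdist_le => e e0.
have [r r0 re] : exists2 r, (0 < r)%N & 2 / r%:R <= e.
  exists (Num.truncn (2 / e)).+1 => //; rewrite ler_pdivrMr ?ltr0n //.
  rewrite mulrC -ler_pdivrMr //; apply: ltW; exact: truncnS_gt.
near=> M; rewrite freq_class distrC; apply: le_trans re.
apply: class_frequency => //; last by rewrite ltn_pmod.
by near: M; exact: nbhs_infty_ge.
Unshelve. all: by end_near. Qed.

Let class_vector M (t : sample M) : {ffun 'I_m -> {ffun 'I_d -> 'I_Q}} :=
  [ffun i => [ffun j => coordinate_class (t i j)]].

Let lift_class (c : {ffun 'I_m -> {ffun 'I_d -> 'I_Q}}) (i : 'I_m) : O :=
  comb omega (fun j => (c i j : nat)%:Z).

Let lift_class_vector M (t : sample M) i :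
  principal Q%:R (position omega (t i) - lift_class (class_vector t) i).
Proof.
have E (A : {set 'I_M}) : exists z : int,
    (#|A|.*2)%:Z - M%:Z - (coordinate_class A : nat)%:Z = z * Q%:Z.
  exists (((#|A|.*2 + M * Q.-1) %/ Q)%N%:Z - M%:Z) => /=.
  have := divn_eq (#|A|.*2 + M * Q.-1) Q.
  have MQ : (M * Q.-1 + M = M * Q)%N by rewrite addnC -mulnS prednK.
  move: (_ %/ Q)%N (_ %% Q)%N MQ => u v MQ H.
  have : ((#|A|.*2 + M * Q.-1)%N%:Z = u%:Z * Q%:Z + v%:Z) by rewrite H PoszD PoszM.
  have : ((M * Q.-1)%N%:Z + M%:Z = M%:Z * Q%:Z) by rewrite -PoszD MQ PoszM.
  rewrite PoszD; move: (M * Q.-1)%N%:Z => X; rewrite mulrBl => <- uQ.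
  by move: (u%:Z * Q%:Z) (#|A|.*2%:Z) (v%:Z) uQ {H} => Y A2 w uQ; rewrite -(addrK X A2) uQ; ring.
have /choice[z Hz] := E.
exists (comb omega (fun j => z (t i j))).
rewrite combM /position /lift_class combN combD; apply: eq_bigr => j _.
by rewrite -Hz !ffunE.
Qed.

(** The independent coordinates of the walks become equidistributed modulo [Q].
    This needs [Q] to be odd: modulo two, each coordinate is congruent to [M]. *)
Lemma residue_event_cvg (V : set ('I_m -> O)) :
  (forall v v', (forall i, principal Q%:R (v i - v' i)) -> V v -> V v') ->
  cvgn (fun M => freq R (fun t : sample M =>
    `[< V (fun i => position omega (t i)) >])).
Proof.
move=> V_mod; pose W c := `[< V (lift_class c) >].
have freqW M : freq R (fun t : sample M => `[< V (fun i => position omega (t i)) >]) =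
    \sum_(c | W c) \prod_i \prod_j freq R (fun A : {set 'I_M} =>
        coordinate_class A == c i j).
  rewrite (@eq_freq _ _ _ (fun t => W (class_vector t))) => [|t]; last first.
    apply/asbool_equiv_eq; split; apply: V_mod => i; first exact: lift_class_vector.
    apply: idealBC; [exact: principal_ideal|exact: lift_class_vector].
  rewrite freq_partition; apply: eq_bigr => c _.
  under [RHS]eq_bigr do rewrite -freq_product.
  rewrite -freq_product; apply: eq_freq => t.
  apply/eqP/forallP => [<- i|H].
    by apply/forallP => j; rewrite !ffunE.
  apply/ffunP => i; apply/ffunP => j; rewrite !ffunE.
  by have /forallP/(_ j)/eqP := H i.
rewrite (_ : (fun M => _) = (fun M => \sum_(c | W c) \prod_i \prod_j
  freq R (fun A : {set 'I_M} => coordinate_class A == c i j))); last first.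
  by apply/funext => M; exact: freqW.
apply/cvg_ex; exists (\sum_(c | W c) \prod_(i : 'I_m) \prod_(j : 'I_d) Q%:R^-1).
apply: (@cvg_sum_seq R _ _ W (fun c M => \prod_i \prod_j
  freq R (fun A : {set 'I_M} => coordinate_class A == c i j))) => c.
apply: (@cvg_prod_seq R _ _ predT (fun i M => \prod_j
  freq R (fun A : {set 'I_M} => coordinate_class A == c i j))) => i.
apply: (@cvg_prod_seq R _ _ predT (fun j M =>
  freq R (fun A : {set 'I_M} => coordinate_class A == c i j))) => j.
exact: coordinate_class_cvg.
Qed.

End Equidistribution.

(** * The limit of the failure probability *)

Section LimitProbability.
Variables (R : realType) (K : fieldExtType rat) (d n : nat).
Hypothesis dimK : \dim {:K} = d.
Variable omega : 'I_d -> ringOfIntegers K.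
Hypothesis basis_omega : integral_basis omega.
Hypothesis d_ge2 : (2 <= d)%N.
Local Notation O := (ringOfIntegers K).
Local Notation m := (n + d)%N.
Variables (L : nat) (a : 'I_m -> O).
Hypothesis L_large : (maxn (n + d) (2 * n + 2) < L)%N.
Hypothesis a_adm : admissible L a.

Let L_ge2 : (2 <= L)%N.
Proof.
apply: leq_trans d_ge2 (leq_trans (leq_addl n d) _).
by move: L_large; rewrite gtn_max => /andP[/ltnW].
Qed.

Definition crowded_between (Y : nat) (x : 'I_m -> O) :=
  exists2 q, prime q /\ (L < q <= Y)%N & crowded L a x q.

Local Notation crowded_above Y := (fun x => crowded_above L a x Y).

Lemma not_universalE (x : 'I_m -> O) :
  ~ universal n (random_set L a x) <-> crowded_above L x.
Proof.
have d_gt0 : (0 < d)%N by exact: ltnW.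
split.
  move=> nuniv; apply: contrapT => ncrowd; apply: nuniv.
  apply/(universal_random_setP dimK basis_omega x d_gt0 L_large a_adm).
  move=> p prime_p p_neq0 npL; apply: contrapT => ndist; apply: ncrowd.
  have [q q_prime pq] := residue_char_exists dimK basis_omega prime_p p_neq0.
  exists q; last by exists p.
  split => //; rewrite ltnNge; apply/negP => qL; apply: npL.
  by apply/(natr_in_prime prime_p q_prime pq); rewrite prime_dvdn_fact.
move=> [q [q_prime Lq] [p [prime_p pq] ndist]].
move=> /(universal_random_setP dimK basis_omega x d_gt0 L_large a_adm) dist.
apply/ndist/dist => //.
  by exists q%:R => //; rewrite O_natr_eq0 -lt0n prime_gt0.
by move=> /(natr_in_prime prime_p q_prime pq); rewrite prime_dvdn_fact // leqNgt Lq.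
Qed.

Lemma crowded_split Y x : crowded_above L x ->
  crowded_between Y x \/ crowded_above Y x.
Proof.
move=> [q [q_prime Lq] crowd]; have [qY|Yq] := leqP q Y.
  by left; exists q => //; rewrite Lq.
by right; exists q.
Qed.

Local Notation prob V :=
  (fun M => freq R (fun t : sample d n M => `[< V (fun i => position omega (t i)) >])).

(** Crowding at the primes between [L] and [Y] depends on the residues of the walks
    modulo the product of these primes, which is odd. *)
Lemma crowded_between_cvg Y : cvgn (prob (crowded_between Y)).
Proof.
pose Q := (\prod_(q <- index_iota L.+1 Y.+1 | prime q) q)%N.
have Q_odd : odd Q.
  rewrite /Q big_seq_cond; apply: (big_ind (fun k => odd k)) => //.
    by move=> k l ? ?; rewrite oddM; apply/andP.
  move=> q /andP[]; rewrite mem_index_iota => /andP[Lq _] q_prime.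
  case: (even_prime q_prime) => // q2; move: (leq_ltn_trans L_ge2 Lq).
  by rewrite q2.
apply: (@residue_event_cvg R K d omega Q m Q_odd (crowded_between Y)).
move=> v v' vv'.
move=> [q [q_prime /andP[Lq qY]] [p [prime_p pq] ndist]].
have [idp _ _] := prime_p.
exists q; first by rewrite Lq.
exists p => // -[B nB dB]; apply: ndist; exists B => // i j iB jB pij.
apply: dB => //.
have qQ : (q %| Q)%N.
  rewrite /Q (big_rem q) /= ?q_prime ?dvdn_mulr //.
  by rewrite mem_index_iota Lq ltnS.
have pvv k : p (v k - v' k).
  have [y ->] := vv' k; apply: ideal_mulr => //.
  by apply/(natr_in_prime prime_p q_prime pq).
have -> : shifted L a v' i - shifted L a v' j = shifted L a v i - shifted L a v j
   + L`!%:R * ((v j - v' j) - (v i - v' i)) by rewrite /shifted; ring.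
by apply: idealD => //; apply: ideal_mull => //; exact: idealB.
Qed.

Lemma crowded_above_le Y (e : R) : (L <= Y)%N -> 0 < e ->
  \forall M \near \oo,
    prob (crowded_above Y) M <= (d * m ^ 4 * 9)%:R / Y%:R + e.
Proof.
move=> LY e0; have [C0 HC0] := enumerate_divisors dimK basis_omega d_ge2 a L_ge2.
set c2 := (m ^ 4 * (d.+1.*2 * d).+1 * 3)%N.
pose r0 := (Num.truncn (c2%:R / e)).+1.
near=> M; have [r [rM Mr]] := isqrt_exists M.
have r0r : (r0 <= r)%N.
  rewrite -ltnS -ltn_sqr; apply: leq_ltn_trans Mr.
  by near: M; exact: nbhs_infty_ge.
have r_gt0 : (0 < r)%N by exact: leq_trans r0r.
have CM : (C0 <= M)%N by near: M; exact: nbhs_infty_ge.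
apply: le_trans (freq_crowded_beyond_le R dimK basis_omega d_ge2 L_ge2 r_gt0 rM
  (HC0 M r CM Mr) LY) _.
rewrite lerD2l -/c2 ler_pdivrMr ?ltr0n // mulrC -ler_pdivrMr //.
apply: ltW; apply: lt_le_trans (truncnS_gt _) _.
by rewrite ler_nat.
Unshelve. all: by end_near. Qed.

(** For fixed [L] the probability of failure converges, being a uniform limit
    of the probabilities of failure at the primes up to [Y]. *)
Lemma limit_probability : exists q : R,
  prob (fun x => ~ universal n (random_set L a x)) @ \oo --> q /\
  0 <= q <= (d * m ^ 4 * 9)%:R / L%:R.
Proof.
have probE : prob (fun x => ~ universal n (random_set L a x)) = prob (crowded_above L).
  apply/funext => M; apply: eq_freq => t; apply/asbool_equiv_eq.
  exact: not_universalE.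
rewrite probE; set c1 : R := (d * m ^ 4 * 9)%:R.
have cv : cvgn (prob (crowded_above L)).
  apply: cvg_of_approximations => e e0.
  have e2 : 0 < e / 2 by rewrite divr_gt0.
  pose Y := maxn L (Num.truncn (c1 / (e / 2))).+1.
  have Y0 : (0 : R) < Y%:R by rewrite ltr0n leq_max orbT.
  exists (prob (crowded_between Y)); first exact: crowded_between_cvg.
  near=> M.
  have above : prob (crowded_above Y) M <= c1 / Y%:R + e / 2.
    by near: M; apply: crowded_above_le => //; rewrite leq_max leqnn.
  have c1Y : c1 / Y%:R <= e / 2.
    rewrite ler_pdivrMr // mulrC -ler_pdivrMr //.
    apply: ltW; apply: lt_le_trans (truncnS_gt _) _.
    by rewrite ler_nat leq_max leqnn orbT.
  rewrite ger0_norm; last first.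
    rewrite subr_ge0; apply: freq_sub => t /asboolP[q [q_prime /andP[Lq qY]] crowd].
    by apply/asboolP; exists q.
  rewrite lerBlDl.
  apply: le_trans
    (_ : _ <= prob (crowded_between Y) M + prob (crowded_above Y) M) _.
    apply: le_trans (freqU _ _ _); apply: freq_sub => t /asboolP/(crowded_split Y)[H|H].
      by apply/orP; left; apply/asboolP.
    by apply/orP; right; apply/asboolP.
  rewrite lerD2l; apply: le_trans above _; rewrite [leRHS](splitr e).
  by rewrite lerD2r.
exists (limn (prob (crowded_above L))); split => //; apply/andP; split.
  by apply: limr_ge => //; apply: nearW => M; exact: freq_ge0.
apply/ler_addgt0Pr => e e0; apply: limr_le => //.
exact: crowded_above_le.
Unshelve. all: by end_near. Qed.

End LimitProbability.

Theorem theorem6p9 (R : realType) (K : fieldExtType rat) (d n : nat)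
  (hdim : \dim {:K} = d) (hd : (2 <= d)%N) (hn : (0 < n)%N)
  (omega : 'I_d -> ringOfIntegers K) (homega : integral_basis omega)
  (a : nat -> 'I_(n + d) -> ringOfIntegers K)
  (ha : forall L : nat, (maxn (n + d) (2 * n + 2) < L)%N -> admissible L (a L))
  (disp : nat -> nat -> measure_display)
  (Omega : forall L M : nat, measurableType (disp L M))
  (Pr : forall L M : nat, probability (Omega L M) R)
  (psi : forall L M : nat, 'I_(n + d) -> {RV (Pr L M) >-> ringOfIntegers K})
  (hindep : forall L M : nat, (maxn (n + d) (2 * n + 2) < L)%N -> (1 <= M)%N ->
     mutually_independent (psi L M))
  (hlaw : forall L M : nat, (maxn (n + d) (2 * n + 2) < L)%N -> (1 <= M)%N ->
     forall (i : 'I_(n + d)) (B : set (ringOfIntegers K)),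
       distribution (Pr L M) (psi L M i) B = walk_law R omega M B) :
  exists q : nat -> R,
    (forall L : nat, (maxn (n + d) (2 * n + 2) < L)%N ->
       (fun M : nat => Pr L M [set w |
          ~ universal n (random_set L (a L) (fun i => psi L M i w))]) @ \oo
         --> (q L)%:E) /\
    q @ \oo --> (0 : R).
Proof.
pose c1 : R := (d * (n + d) ^ 4 * 9)%:R.
have /choice[q Hq] : forall L, exists q : R, (maxn (n + d) (2 * n + 2) < L)%N ->
    (fun M => freq R (fun t : sample d n M => `[< ~ universal n
        (random_set L (a L) (fun i => position omega (t i))) >])) @ \oo --> q /\
    0 <= q <= c1 / L%:R.
  move=> L; have [hL|nL] := boolP (maxn (n + d) (2 * n + 2) < L)%N; last by exists 0.
  by have [q Hq] := limit_probability R hdim homega hd hL (ha L hL); exists q.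
exists q; split => [L hL|].
  have [cv _] := Hq L hL.
  apply: (@cvg_trans _ ((EFin \o (fun M => freq R (fun t : sample d n M =>
      `[< ~ universal n (random_set L (a L) (fun i => position omega (t i))) >]))) @ \oo)).
    apply: near_eq_cvg; near=> M; rewrite /=.
    have M1 : (1 <= M)%N by near: M; exact: nbhs_infty_ge.
    by rewrite -(joint_law homega (hindep L M hL M1) (hlaw L M hL M1)
      (fun x => ~ universal n (random_set L (a L) x))).
  by apply: cvg_EFin; [exact: nearW|exact: cv].
apply/cvgrPdist_le => e e0; near=> L.
have hL : (maxn (n + d) (2 * n + 2) < L)%N by near: L; exact: nbhs_infty_gt.
have [_ /andP[q0 qL]] := Hq L hL.
rewrite sub0r normrN ger0_norm //; apply: le_trans qL _.
have L0 : (0 : R) < L%:R by rewrite ltr0n (leq_ltn_trans _ hL).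
rewrite ler_pdivrMr // mulrC -ler_pdivrMr //.
apply: ltW; apply: lt_le_trans (truncnS_gt _) _.
by rewrite ler_nat; near: L; exact: nbhs_infty_ge.
Unshelve. all: by end_near. Qed.
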